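(* Let $H$ be a subgraph of a graph $G$ on $[n]$ such that $\mathcal E_G$ is a finitely generated left $\mathcal E_H$-module, and let $M\subset\mathcal E_G$ be a set of homogeneous right minimal coset representatives for $\mathcal E_H$ (i.e. a basis of $\mathcal E_G$ as a free left $\mathcal E_H$-module consisting of homogeneous elements). Then: (a) $M$ has a unique element $m_0$ of maximum degree; (b) for every $m\in M$ there exists $q^\vee\in\mathcal E_n^\vee$ with $q^\vee(\mathcal E_H^+\mathcal E_n)=0$ and $m\equiv q^\vee*m_0\pmod{\mathcal E_H^+\mathcal E_G}$; (c) for every $m\in M$ there exists $g\in\mathcal E_G$ with $m_0\equiv mg\pmod{\mathcal E_H^+\mathcal E_G}$.
   Context: Let $n\ge 1$. The Fomin–Kirillov algebra $\mathcal E_n$ is the associative $\mathbb Q$-algebra with generators $x_{ij}$ for ordered pairs of distinct $i,j\in[n]$, subject to $x_{ij}=-x_{ji}$, $x_{ij}^2=0$, $x_{ij}x_{kl}=x_{kl}x_{ij}$ for distinct $i,j,k,l$, and $x_{ij}x_{jk}+x_{jk}x_{ki}+x_{ki}x_{ij}=0$ for distinct $i,j,k$. It is graded by degree; $\mathcal E_n^d$ is the degree-$d$ part. For a simple graph $G$ on vertex set $[n]$, $\mathcal E_G$ is the subalgebra of $\mathcal E_n$ generated by the $x_{ij}$ with $\{i,j\}$ an edge of $G$, $\mathcal E_G^+$ its positive-degree part; $\mathcal E_H^+\mathcal E_G$ (resp. $\mathcal E_H^+\mathcal E_n$) is the span of products $ab$ with $a\in\mathcal E_H^+$ and $b\in\mathcal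 E_G$ (resp. $b\in\mathcal E_n$). It is known that $\mathcal E_G$ is a free left $\mathcal E_H$-module for $H\subseteq G$. $\mathcal E_n$ is also graded by $S_n$: the $S_n$-degree of $x_{ij}$ is the transposition $(i\,j)$, extended multiplicatively to monomials; $\sigma_P$ denotes the $S_n$-degree of an $S_n$-homogeneous $P$; $S_n$ acts by automorphisms via $\sigma(x_{ij})=x_{\sigma(i)\sigma(j)}$. Equip $\mathcal E_n\otimes\mathcal E_n$ with the braided product $(P_1\otimes Q_1)(P_2\otimes Q_2)=P_1\sigma_{Q_1}(P_2)\otimes Q_1Q_2$ for $S_n$-homogeneous $Q_1$. The coproduct $\Delta:\mathcal E_n\to\mathcal E_n\otimes\mathcal E_n$ is the (well-defined) map multiplicative for this product with $\Delta(x_{ij})=x_{ij}\otimes1+1\otimes x_{ij}$. Let $\mathcal E_n^\vee=\bigoplus_d(\mathcal E_n^d)^*$; for $p^\vee\in\mathcal E_n^\vee$ and $Q$ with $\Delta(Q)=\sum_k Q^k_{(1)}\otimes Q^k_{(2)}$, set $p^\vee*Q=\sum_k p^\vee(Q^k_{(1)})\,Q^k_{(2)}$. *)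

(* Defs.v *)
(* Concrete model of the Fomin-Kirillov algebra E_n as the
   quotient of the free Q-algebra on letters (i,j) (i,j < n, i <> j) by the
   two-sided ideal of its defining relations. Vertex set [n] = {0,...,n-1}. *)
From HB Require Import structures.
From mathcomp Require Import all_boot all_order all_algebra.
Set Implicit Arguments. Unset Strict Implicit. Unset Printing Implicit Defensive.
Import Order.TTheory GRing.Theory Num.Theory.
Local Open Scope ring_scope.

(* a letter (i,j) stands for the generator x_ij *)
Definition letter := (nat * nat)%type.
Definition word := seq letter.
(* formal Q-linear combinations of words (elements of the free algebra) *)
Definition fpoly := seq (rat * word).

Definition coef (P : fpoly) (w : word) : rat := \sum_(t <- P | t.2 == w) t.1.
Definition pscale (c : rat) (P : fpoly) : fpoly := [seq (c * t.1, t.2) | t <- P].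
Definition popp (P : fpoly) : fpoly := pscale (-1) P.
Definition pmul (P Q : fpoly) : fpoly :=
  [seq (t.1 * s.1, t.2 ++ s.2) | t <- P, s <- Q].
Definition pword (w : word) : fpoly := [:: (1, w)].

Definition is_graph (n : nat) (G : rel nat) : Prop :=
  (forall i j, G i j -> [/\ (i < n)%N, (j < n)%N & i != j]) /\
  (forall i j, G i j = G j i).
Definition Kn (n : nat) : rel nat := fun i j => [&& (i < n)%N, (j < n)%N & i != j].
Definition gword (G : rel nat) (w : word) : bool := all (fun a => G a.1 a.2) w.

Definition fk_rel (n : nat) (r : fpoly) : Prop :=
  (exists i j, Kn n i j /\ r = [:: (1, [:: (i, j)]); (1, [:: (j, i)])]) \/
  (exists i j, Kn n i j /\ r = [:: (1, [:: (i, j); (i, j)])]) \/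
  (exists i j k l, uniq [:: i; j; k; l] /\ all (fun x => (x < n)%N) [:: i; j; k; l] /\
     r = [:: (1, [:: (i, j); (k, l)]); (-1, [:: (k, l); (i, j)])]) \/
  (exists i j k, uniq [:: i; j; k] /\ all (fun x => (x < n)%N) [:: i; j; k] /\
     r = [:: (1, [:: (i, j); (j, k)]); (1, [:: (j, k); (k, i)]); (1, [:: (k, i); (i, j)])]).

Inductive inI (n : nat) : fpoly -> Prop :=
| inI_nil : inI n [::]
| inI_rel u r v : gword (Kn n) u -> gword (Kn n) v -> fk_rel n r ->
    inI n (pmul (pword u) (pmul r (pword v)))
| inI_add P Q : inI n P -> inI n Q -> inI n (P ++ Q)
| inI_scale c P : inI n P -> inI n (pscale c P)
| inI_ext P Q : (forall w, coef P w = coef Q w) -> inI n P -> inI n Q.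

Definition eqFK (n : nat) (P Q : fpoly) : Prop := inI n (P ++ popp Q).

Definition inEG (n : nat) (G : rel nat) (P : fpoly) : Prop :=
  exists Q : fpoly, (forall t, t \in Q -> gword G t.2) /\ eqFK n P Q.
Definition inEGp (n : nat) (G : rel nat) (P : fpoly) : Prop :=
  exists Q : fpoly, (forall t, t \in Q -> gword G t.2 && (0 < size t.2)%N) /\ eqFK n P Q.

Definition homog (n d : nat) (P : fpoly) : Prop :=
  exists Q : fpoly, (forall t, t \in Q -> size t.2 = d) /\ eqFK n P Q.

Definition inProd (n : nat) (H G : rel nat) (P : fpoly) : Prop :=
  exists s : seq (fpoly * fpoly),
    (forall ab, ab \in s -> inEGp n H ab.1 /\ inEG n G ab.2) /\
    eqFK n P (flatten [seq pmul ab.1 ab.2 | ab <- s]).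

Definition eqmod (n : nat) (H G : rel nat) (P Q : fpoly) : Prop :=
  inProd n H G (P ++ popp Q).

Definition lincomb (a M : seq fpoly) : fpoly :=
  flatten [seq pmul x.1 x.2 | x <- zip a M].

Definition fin_gen (n : nat) (H G : rel nat) : Prop :=
  exists gens : seq fpoly, (forall g, g \in gens -> inEG n G g) /\
    forall P, inEG n G P -> exists a : seq fpoly,
      [/\ size a = size gens, (forall x, x \in a -> inEG n H x) & eqFK n P (lincomb a gens)].

Definition is_basis (n : nat) (H G : rel nat) (M : seq fpoly) : Prop :=
  [/\ (forall m, m \in M -> inEG n G m),
      (forall P, inEG n G P -> exists a : seq fpoly,
         [/\ size a = size M, (forall x, x \in a -> inEG n H x) & eqFK n P (lincomb a M)]) &
      (forall a : seq fpoly, size a = size M -> (forall x, x \in a -> inEG n H x) ->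
         eqFK n (lincomb a M) [::] -> forall x, x \in a -> eqFK n x [::])].

(* graded dual E_n^vee = (+)_d (E_n^d)^* : a functional is given by its values
   phi on words, extended linearly; it must vanish on the ideal and on all
   words of large degree *)
Definition ev (phi : word -> rat) (P : fpoly) : rat := \sum_(t <- P) t.1 * phi t.2.
Definition is_dual (n : nat) (phi : word -> rat) : Prop :=
  (forall P, inI n P -> ev phi P = 0) /\ exists D : nat, forall w, (D < size w)%N -> phi w = 0.

Definition tperm (a : letter) (i : nat) : nat :=
  if i == a.1 then a.2 else if i == a.2 then a.1 else i.
Definition sigmaw (a : letter) (w : word) : word :=
  [seq (tperm a b.1, tperm a b.2) | b <- w].

(* braided coproduct of a word: Delta(x_a w) = (x_a (x) 1 + 1 (x) x_a) Delta(w),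
   where (1 (x) x_a)(P (x) Q) = sigma_a(P) (x) x_a Q *)
Fixpoint cop (w : word) : seq (rat * word * word) :=
  match w with
  | [::] => [:: (1, [::], [::])]
  | a :: w' => [seq (t.1.1, a :: t.1.2, t.2) | t <- cop w'] ++
               [seq (t.1.1, sigmaw a t.1.2, a :: t.2) | t <- cop w']
  end.

Definition star (phi : word -> rat) (P : fpoly) : fpoly :=
  flatten [seq [seq (t.1 * s.1.1 * phi s.1.2, s.2) | s <- cop t.2] | t <- P].

(* Main.v *)
(* Everything is lifted to the free algebra: I is the ideal of relations, K the preimage of
   E_H^+ E_G and L that of E_H^+ E_n. Modulo K, the set M is a homogeneous Q-basis of E_G.

   Freeness of E_n over E_G enters only through L /\ E_G = K. If pi is a projection along
   E_G^+ E_n, then Q |-> sum Q1 pi(Q2) is left E_G-linear, and applying it to an element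
   sum k_w w of L /\ E_G, with k_w in E_H^+ E_G, lowers the degrees of the tails w until
   only an element of K remains.

   Functionals Phi that kill L act on E_G / K by T_Phi : Q |-> sum Phi(Q1, Q2) Q2, where Phi
   may also depend on the S_n-degree of Q2, and for every generator a of E_G
     T_Phi'(v) + T_Phi(v) a = T_Phi''(v a)
   for two other such families Phi', Phi''. Let w0 be a word of top degree outside K. Since
   w0 a lies in K, the elements T_Phi(w0) modulo K form a right ideal; it contains 1, because
   some functional killing L does not kill w0. This is (b), and comparing degrees, the top
   degree of E_G / K is the line of w0, which is (a). If m w lay in K for all words w of the
   complementary degree, the span of the T_Phi(m w) of degree below the top would likewise be
   a right ideal modulo K containing 1, yet it misses w0: this is (c). *)
Require Import Defs.
From HB Require Import structures.
From mathcomp Require Import all_boot all_order all_algebra.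
From mathcomp Require Import finmap monalg.
From Stdlib Require Import Classical.
Import Order.TTheory GRing.Theory Num.Theory.
Set Implicit Arguments. Unset Strict Implicit. Unset Printing Implicit Defensive.
Local Open Scope ring_scope.

(** * The free algebra as a vector space *)

(** Only the universal property and generation are exposed. Linear independence of the generators is
    recovered from coordinate functionals built with [fm_lin], see [coefF_eq0]. *)
Record free_module (T : Type) := FreeModule {
  fm_sort : lmodType rat;
  fm_gen : T -> fm_sort;
  fm_lin : forall W : lmodType rat, (T -> W) -> {linear fm_sort -> W};
  fm_linE : forall (W : lmodType rat) (f : T -> W) w, fm_lin f (fm_gen w) = f w;
  fm_genP : forall v : fm_sort,
    exists P : seq (rat * T), v = \sum_(t <- P) t.1 *: fm_gen t.2 }.

Section MalgLin.
Variables (T : choiceType) (W : lmodType rat) (f : T -> W).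

Definition malg_lin (g : {malg rat[T]}) : W := \sum_(k <- msupp g) g@_k *: f k.

Lemma malg_lin_wide (d : {fset T}) g : (msupp g `<=` d)%fset ->
  malg_lin g = \sum_(k <- d) g@_k *: f k.
Proof.
move=> sd; rewrite /malg_lin; apply: big_fset_incl => // k _ /mcoeff_outdom ->.
by rewrite scale0r.
Qed.

Lemma malg_lin_linear : linear malg_lin.
Proof.
move=> c g h; pose d := (msupp g `|` msupp h `|` msupp (c *: g + h))%fset.
have sub k : k \in msupp g \/ k \in msupp h \/ k \in msupp (c *: g + h) -> k \in d.
  by rewrite !in_fsetU => -[->|[->|->]]; rewrite ?orbT.
rewrite !(@malg_lin_wide d); do ?[by apply/fsubsetP => k kd; apply: sub; auto].
rewrite scaler_sumr -big_split /=; apply: eq_bigr => k _.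
by rewrite mcoeffD mcoeffZ scalerDl scalerA.
Qed.

HB.instance Definition _ :=
  GRing.isLinear.Build rat {malg rat[T]} W _ malg_lin malg_lin_linear.

Definition malg_linfun : {linear {malg rat[T]} -> W} := malg_lin.

Lemma malg_linE w : malg_linfun << w >> = f w.
Proof. by rewrite /= /malg_lin msuppU oner_eq0 big_seq_fset1 mcoeffUU scale1r. Qed.
End MalgLin.

(* Opaque on purpose: unification must not unfold the finitely supported functions. *)
Lemma free_module_exists (T : choiceType) : free_module T.
Proof.
apply: (@FreeModule T {malg rat[T]} (fun w => << w >>) (@malg_linfun T) (@malg_linE T)).
move=> v; exists [seq (v@_k, k) | k <- msupp v].
rewrite big_map {1}[v]monalgE; apply: eq_bigr => k _ /=.
by apply/malgP => k0; rewrite mcoeffZ !mcoeffU; case: eqP => _; rewrite ?mulr1n ?mulr0n ?mulr1 ?mulr0.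
Qed.

Definition FA : lmodType rat := fm_sort (free_module_exists word).
Definition e (w : word) : FA := fm_gen (free_module_exists word) w.
Definition lin (W : lmodType rat) (f : word -> W) : {linear FA -> W} :=
  fm_lin (free_module_exists word) f.

Lemma linE (W : lmodType rat) (f : word -> W) w : @lin W f (e w) = f w.
Proof. exact: fm_linE. Qed.

Definition toF (P : fpoly) : FA := \sum_(t <- P) t.1 *: e t.2.

Lemma toFP (v : FA) : exists P, v = toF P.
Proof. exact: fm_genP. Qed.

Lemma lin_toF (W : lmodType rat) (f : word -> W) P : lin f (toF P) = \sum_(t <- P) t.1 *: f t.2.
Proof. by rewrite linear_sum; apply: eq_bigr => t _; rewrite linearZ /= linE. Qed.

Lemma lin_unique (W : lmodType rat) (f g : {linear FA -> W}) :
  (forall w, f (e w) = g (e w)) -> f =1 g.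
Proof.
move=> fg v; have [P ->] := toFP v; rewrite !linear_sum.
by apply: eq_bigr => t _; rewrite !linearZ /= fg.
Qed.

Lemma lin_ext (W : lmodType rat) (f g : word -> W) : f =1 g -> lin f =1 lin g.
Proof. by move=> fg; apply: lin_unique => w; rewrite !linE fg. Qed.

Lemma lin_id v : lin e v = v.
Proof. by have [P ->] := toFP v; rewrite lin_toF. Qed.

Section Span.
Variable V : lmodType rat.
Implicit Types (A B : V -> Prop).

(** Subspaces are predicates in [Prop], as membership in the ideal comes with no decision procedure.
    An inductive span turns each inclusion into a check on generators ([linspan_min]). *)
Inductive linspan A : V -> Prop :=
| linspan_gen v of A v : linspan A v
| linspan0 : linspan A 0
| linspanD u v of linspan A u & linspan A v : linspan A (u + v)
| linspanZ c v of linspan A v : linspan A (c *: v).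

Definition subspace A :=
  [/\ A 0, (forall u v, A u -> A v -> A (u + v)) & (forall c v, A v -> A (c *: v))].

Lemma linspan_subspace A : subspace (linspan A).
Proof. by split; [exact: linspan0|exact: linspanD|exact: linspanZ]. Qed.

Lemma linspan_min A B : subspace B -> (forall v, A v -> B v) -> forall v, linspan A v -> B v.
Proof. case=> B0 BD BZ AB v.
by elim=> [w /AB //| //|u w _ Bu _ Bw|c w _ Bw]; [apply: BD|apply: BZ]. Qed.

Lemma linspan_sub A B : (forall v, A v -> B v) -> forall v, linspan A v -> linspan B v.
Proof. by move=> AB; apply: linspan_min (linspan_subspace B) _ => v /AB; apply: linspan_gen. Qed.

Lemma subspaceN A v : subspace A -> A v -> A (- v).
Proof. by case=> _ _ AZ /(AZ (-1)); rewrite scaleN1r. Qed.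

Lemma subspaceB A u v : subspace A -> A u -> A v -> A (u - v).
Proof. by move=> sA Au Av; have [_ AD _] := sA; apply: AD => //; apply: subspaceN. Qed.

Lemma subspace_sum A (I : eqType) (s : seq I) (F : I -> V) :
  subspace A -> (forall i, i \in s -> A (F i)) -> A (\sum_(i <- s) F i).
Proof.
case=> A0 AD _; elim: s => [|i s IH] AF; first by rewrite big_nil.
rewrite big_cons; apply: AD; first by apply: AF; rewrite mem_head.
by apply: IH => j js; apply: AF; rewrite inE js orbT.
Qed.

Lemma linspanB A u v : linspan A u -> linspan A v -> linspan A (u - v).
Proof. exact: subspaceB (linspan_subspace A). Qed.

Lemma linspanN A v : linspan A v -> linspan A (- v).
Proof. exact: subspaceN (linspan_subspace A). Qed.

End Span.

Lemma subspace_preim (V W : lmodType rat) (f : {linear V -> W}) B :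
  subspace B -> subspace (fun v => B (f v)).
Proof.
case=> B0 BD BZ; split=> [|u v|c v]; rewrite ?linear0 ?linearD ?linearZ //.
  exact: BD.
exact: BZ.
Qed.

Lemma subspace_eq0 (V : lmodType rat) : subspace (fun v : V => v = 0).
Proof. by split=> [|u v -> ->|c v ->]; rewrite ?addr0 ?scaler0. Qed.

Lemma linspan_lin (V W : lmodType rat) (f : {linear V -> W}) A B : subspace B ->
  (forall v, A v -> B (f v)) -> forall v, linspan A v -> B (f v).
Proof. by move=> sB AB; apply: (linspan_min (subspace_preim f sB)). Qed.

Lemma lin_sumZ (W : lmodType rat) (I : Type) (s : seq I) (c : I -> rat) (F : I -> word -> W) v :
  lin (fun w => \sum_(i <- s) c i *: F i w) v = \sum_(i <- s) c i *: lin (F i) v.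
Proof.
have [P ->] := toFP v; rewrite lin_toF.
under eq_bigr do rewrite scaler_sumr.
rewrite exchange_big; apply: eq_bigr => i _ /=; rewrite lin_toF scaler_sumr.
by apply: eq_bigr => t _; rewrite !scalerA mulrC.
Qed.

(** * The ideal of relations and the coproduct *)

Section Transpositions.
Variable a : letter.

Lemma tpermK : involutive (tperm a).
Proof.
move=> i; rewrite /tperm; case: (eqVneq i a.1) => [->|i1].
  by case: (eqVneq a.2 a.1) => [->|_]; rewrite ?eqxx.
case: (eqVneq i a.2) => [->|i2]; first by rewrite eqxx.
by rewrite (negbTE i1) (negbTE i2).
Qed.

Lemma tperm_inj : injective (tperm a).
Proof. exact: can_inj tpermK. Qed.

Lemma sigmaw_cat u v : sigmaw a (u ++ v) = sigmaw a u ++ sigmaw a v.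
Proof. exact: map_cat. Qed.

Lemma size_sigmaw u : size (sigmaw a u) = size u.
Proof. exact: size_map. Qed.

Variable n : nat.
Hypothesis an : Kn n a.1 a.2.

Lemma tperm_lt i : (tperm a i < n)%N = (i < n)%N.
Proof.
have lt j : (j < n)%N -> (tperm a j < n)%N.
  by case/and3P: an => a1 a2 _ jn; rewrite /tperm; case: eqP => // _; case: eqP.
by apply/idP/idP => [/lt|/lt //]; rewrite tpermK.
Qed.

Lemma Kn_tperm i j : Kn n (tperm a i) (tperm a j) = Kn n i j.
Proof. by rewrite /Kn !tperm_lt (inj_eq tperm_inj). Qed.

Lemma gword_sigmaw u : gword (Kn n) (sigmaw a u) = gword (Kn n) u.
Proof. by rewrite /gword all_map; apply: eq_all => b /=; rewrite Kn_tperm. Qed.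

Lemma fk_rel_sigmaw r : fk_rel n r -> fk_rel n [seq (t.1, sigmaw a t.2) | t <- r].
Proof.
have allt (s : seq nat) : all (fun x => (x < n)%N) s ->
    all (fun x => (x < n)%N) (map (tperm a) s).
  by rewrite all_map => /allP h; apply/allP => x /h /=; rewrite tperm_lt.
case=> [[i [j [ij ->]]]|[[i [j [ij ->]]]|[[i [j [k [l [U [L ->]]]]]]|[i [j [k [U [L ->]]]]]]]].
- by left; exists (tperm a i), (tperm a j); rewrite Kn_tperm.
- by right; left; exists (tperm a i), (tperm a j); rewrite Kn_tperm.
- right; right; left; exists (tperm a i), (tperm a j), (tperm a k), (tperm a l).
  by split; [rewrite -(map_inj_uniq tperm_inj) in U|split; [exact: (allt [:: i; j; k; l])|]].
- right; right; right; exists (tperm a i), (tperm a j), (tperm a k).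
  by split; [rewrite -(map_inj_uniq tperm_inj) in U|split; [exact: (allt [:: i; j; k])|]].
Qed.
End Transpositions.

Section Ideal.
Variable n : nat.

Definition insertion (V : lmodType rat) (f : word -> V) (u : word) (r : fpoly) (v : word) : V :=
  \sum_(t <- r) t.1 *: f (u ++ t.2 ++ v).

Definition relator (x : FA) : Prop := exists u r v,
  [/\ gword (Kn n) u, gword (Kn n) v, fk_rel n r & x = insertion e u r v].

Definition ideal : FA -> Prop := linspan relator.

(** The subspace [W] stands for the quotient [V/W], which is never formed: by [lin_ideal], such an
    [f] descends modulo [ideal n] to a map into [V/W]. *)
Definition respects (V : lmodType rat) (W : V -> Prop) (f : word -> V) : Prop :=
  forall u r v, gword (Kn n) u -> gword (Kn n) v -> fk_rel n r -> W (insertion f u r v).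

Lemma lin_insertion (V : lmodType rat) (f : word -> V) u r v :
  lin f (insertion e u r v) = insertion f u r v.
Proof. by rewrite linear_sum; apply: eq_bigr => t _; rewrite linearZ /= linE. Qed.

Lemma lin_ideal (V : lmodType rat) (W : V -> Prop) (f : word -> V) :
  subspace W -> respects W f -> forall v, ideal v -> W (lin f v).
Proof.
move=> sW Wf; apply: linspan_lin => // _ [u [r [v [un vn rn ->]]]].
by rewrite lin_insertion; apply: Wf.
Qed.

Section Respects.
Variables (V : lmodType rat) (W : V -> Prop).

Lemma respects_cons (f : word -> V) a : Kn n a.1 a.2 ->
  respects W f -> respects W (fun x => f (a :: x)).
Proof. by move=> an Wf u r v un vn rn; apply: (Wf (a :: u)) => //=; rewrite an. Qed.

Lemma respects_sigmaw (f : word -> V) a : Kn n a.1 a.2 ->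
  respects W f -> respects W (fun x => f (sigmaw a x)).
Proof.
move=> an Wf u r v un vn rn; rewrite -(gword_sigmaw an) in un; rewrite -(gword_sigmaw an) in vn.
have := Wf _ _ _ un vn (fk_rel_sigmaw an rn); congr W.
by rewrite /insertion big_map; apply: eq_bigr => t _; rewrite !sigmaw_cat.
Qed.
End Respects.
End Ideal.

(** Sweedler notation without a tensor product: a bilinear map given on pairs of words is applied to
    the coproduct of [w]. *)
Definition copsum (V : lmodType rat) (f : word -> word -> V) (w : word) : V :=
  \sum_(s <- cop w) s.1.1 *: f s.1.2 s.2.

Section Copsum.
Variable V : lmodType rat.
Implicit Types f g : word -> word -> V.

Lemma copsum_nil f : copsum f [::] = f [::] [::].
Proof. by rewrite /copsum big_seq1 scale1r. Qed.

Lemma copsum_cons f a w : copsum f (a :: w) =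
  copsum (fun x y => f (a :: x) y) w + copsum (fun x y => f (sigmaw a x) (a :: y)) w.
Proof. by rewrite /copsum /= big_cat !big_map. Qed.

Lemma copsum_add f g w : copsum (fun x y => f x y + g x y) w = copsum f w + copsum g w.
Proof. by rewrite /copsum -big_split; apply: eq_bigr => s _; rewrite scalerDr. Qed.

Lemma copsum_scale c f w : copsum (fun x y => c *: f x y) w = c *: copsum f w.
Proof. by rewrite /copsum scaler_sumr; apply: eq_bigr => s _; rewrite !scalerA mulrC. Qed.

Lemma copsum_ext f g w : (forall x y, f x y = g x y) -> copsum f w = copsum g w.
Proof. by move=> fg; apply: eq_bigr => s _; rewrite fg. Qed.

Lemma copsum_lin (U : lmodType rat) (h : {linear V -> U}) f w :
  h (copsum f w) = copsum (fun x y => h (f x y)) w.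
Proof. by rewrite linear_sum; apply: eq_bigr => s _; rewrite linearZ. Qed.

Lemma copsum_in (A : V -> Prop) (P : rel word) f w : subspace A ->
  (forall s, s \in cop w -> P s.1.2 s.2) ->
  (forall x y, P x y -> A (f x y)) -> A (copsum f w).
Proof.
move=> sA cP PA; apply: subspace_sum => // s /cP /PA; case: sA => _ _; exact.
Qed.
End Copsum.

Lemma copsum0 (V : lmodType rat) (w : word) : copsum (fun _ _ => 0 : V) w = 0.
Proof. by rewrite /copsum big1 // => s _; rewrite scaler0. Qed.

(** Such [f] play the role of linear maps from the tensor square of E_n to [V/W]: a relator may be
    put in either argument. *)
Definition birespects n (V : lmodType rat) (W : V -> Prop) (f : word -> word -> V) : Prop :=
  (forall y, gword (Kn n) y -> respects n W (f^~ y)) /\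
  (forall x, gword (Kn n) x -> respects n W (f x)).

Section CopsumRespects.
Variables (n : nat) (V : lmodType rat) (W : V -> Prop).
Hypothesis sW : subspace W.

Lemma birespects_left f a : Kn n a.1 a.2 ->
  birespects n W f -> birespects n W (fun x y => f (a :: x) y).
Proof. move=> an [f1 f2]; split=> [y yn|x xn]; first exact: (respects_cons an (f1 y yn)).
by apply: f2; rewrite /gword /= an. Qed.

Lemma birespects_right f a : Kn n a.1 a.2 ->
  birespects n W f -> birespects n W (fun x y => f (sigmaw a x) (a :: y)).
Proof.
move=> an [f1 f2]; split=> [y yn|x xn].
  by apply: (@respects_sigmaw n V W (f^~ (a :: y))) => //; apply: f1; rewrite /gword /= an.
by apply: respects_cons => //; apply: f2; rewrite gword_sigmaw.
Qed.

Lemma gword_cop w : gword (Kn n) w ->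
  forall s, s \in cop w -> gword (Kn n) s.1.2 && gword (Kn n) s.2.
Proof.
elim: w => [_ s|a w IH /= /andP[an wn] s]; first by rewrite inE => /eqP ->.
rewrite mem_cat => /orP[] /mapP[t /(IH wn) /andP[t1 t2] ->] /=.
  by rewrite /gword /= an; apply/andP.
by rewrite gword_sigmaw // /gword /= an; apply/andP.
Qed.

Lemma copsum_Kn f w : gword (Kn n) w ->
  (forall x y, gword (Kn n) x -> gword (Kn n) y -> W (f x y)) -> W (copsum f w).
Proof.
move=> wn Wf; apply: (copsum_in (P := fun x y => gword (Kn n) x && gword (Kn n) y)) => //.
  exact: gword_cop.
by move=> x y /andP[]; apply: Wf.
Qed.

Lemma Kn_sym i j : Kn n i j = Kn n j i.
Proof. by rewrite /Kn andbCA eq_sym. Qed.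

Lemma fk_rel_antisym i j : Kn n i j -> fk_rel n [:: (1, [:: (i, j)]); (1, [:: (j, i)])].
Proof. by move=> ij; left; exists i, j. Qed.

Lemma sigmaw_sym i j w : sigmaw (i, j) w = sigmaw (j, i) w.
Proof.
by apply: eq_map => b; rewrite /tperm /=; congr pair;
  case: eqP => [->|]; case: eqP => // ->.
Qed.

Lemma tpermE1 i j : tperm (i, j) i = j.
Proof. by rewrite /tperm /= eqxx. Qed.

Lemma tpermE2 i j : tperm (i, j) j = i.
Proof. by rewrite /tperm /= eqxx; case: eqP. Qed.

Lemma tpermD i j k : k != i -> k != j -> tperm (i, j) k = k.
Proof. by rewrite /tperm /= => /negbTE -> /negbTE ->. Qed.

Lemma sigmaw_cons a i j w : sigmaw a ((i, j) :: w) = (tperm a i, tperm a j) :: sigmaw a w.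
Proof. by []. Qed.

Lemma eq_sigmaw2 a b c d w : (forall p, tperm a (tperm b p) = tperm c (tperm d p)) ->
  sigmaw a (sigmaw b w) = sigmaw c (sigmaw d w).
Proof. by move=> E; rewrite /sigmaw -!map_comp; apply: eq_map => p /=; rewrite !E. Qed.

Lemma tperm_commute i j k l p : uniq [:: i; j; k; l] ->
  tperm (i, j) (tperm (k, l) p) = tperm (k, l) (tperm (i, j) p).
Proof.
move=> U; have U' : [&& i != j, i != k, i != l, j != k, j != l & k != l].
  by move: U; rewrite /= !inE !negb_or -!andbA andbT.
case/and5P: U' => ij ik il jk /andP[jl kl].
case: (eqVneq p i) => [->|pi].
  by rewrite (tpermD ik il) tpermE1 (tpermD jk jl).
case: (eqVneq p j) => [->|pj].
  by rewrite (tpermD jk jl) tpermE2 (tpermD ik il).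
rewrite [tperm (i, j) p]tpermD //; apply: tpermD.
  by rewrite -[X in _ != X](tpermD ik il) (inj_eq (@tperm_inj _)).
by rewrite -[X in _ != X](tpermD jk jl) (inj_eq (@tperm_inj _)).
Qed.

Lemma tperm_cycle i j k p : uniq [:: i; j; k] ->
  tperm (i, j) (tperm (j, k) p) = tperm (j, k) (tperm (k, i) p).
Proof.
move=> U; have /and3P[ij ik jk] : [&& i != j, i != k & j != k].
  by move: U; rewrite /= !inE !negb_or -!andbA andbT.
case: (eqVneq p i) => [->|pi].
  by rewrite (tpermD ij ik) tpermE1 tpermE2 tpermE2.
case: (eqVneq p j) => [->|pj].
  by rewrite tpermE1 (@tpermD k i j jk) 1?eq_sym // tpermE1 tpermD // eq_sym.
case: (eqVneq p k) => [->|pk].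
  by rewrite tpermE2 tpermE1 tpermE2 tpermD.
by rewrite (@tpermD j k) // (@tpermD i j) // (@tpermD k i) // tpermD.
Qed.

(** The coproduct is compatible with each relation: the terms of Delta(r v) with all letters of [r]
    on one side again form a relation, and the mixed terms cancel in pairs, either exactly or by
    antisymmetry. *)
Lemma copsum_fk_rel f r v : birespects n W f -> fk_rel n r -> gword (Kn n) v ->
  W (insertion (copsum f) [::] r v).
Proof.
move=> [f1 f2] rn vn; have [W0 WD WZ] := sW.
have w1 s x y : gword (Kn n) y -> fk_rel n s -> gword (Kn n) x ->
    W (insertion (f^~ y) [::] s x).
  by move=> yn sn xn; apply: f1.
have w2 s x y : gword (Kn n) x -> fk_rel n s -> gword (Kn n) y ->
    W (insertion (f x) [::] s y).
  by move=> xn sn yn; apply: f2.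
have anti i j x y : Kn n i j -> gword (Kn n) x -> gword (Kn n) y ->
    W (f ((i, j) :: x) y + f ((j, i) :: x) y).
  move=> ij xn yn; have := w1 _ x y yn (fk_rel_antisym ij) xn.
  by rewrite /insertion !big_cons big_nil /= !scale1r addr0.
case: (rn) => [[i [j [ij E]]]|[[i [j [ij E]]]|[[i [j [k [l [U [L E]]]]]]|[i [j [k [U [L E]]]]]]]].
- rewrite E /insertion !big_cons big_nil /= !copsum_cons !scale1r addr0 -!copsum_add.
  apply: copsum_Kn => // x y xn yn; rewrite addrACA.
  apply: (WD); first exact: anti.
  have xn' : gword (Kn n) (sigmaw (i, j) x) by rewrite gword_sigmaw.
  have := w2 r _ y xn' rn yn.
  by rewrite E /insertion !big_cons big_nil /= !scale1r addr0 [in X in _ + X]sigmaw_sym.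
- rewrite E /insertion !big_cons big_nil /= !copsum_cons !scale1r addr0 -!addrA -!copsum_add.
  apply: copsum_Kn => // x y xn yn; rewrite !addrA.
  (* The twist by (i j) turns x_ij into x_ji, so the two mixed terms form an antisymmetry
     relation. *)
  rewrite -[_ + _ + f (sigmaw (i, j) ((i, j) :: x)) _]addrA sigmaw_cons tpermE1 tpermE2.
  apply: (WD); first apply: (WD).
  + have := w1 r x y yn rn xn.
    by rewrite E /insertion !big_cons big_nil /= !scale1r addr0.
  + by apply: anti => //; rewrite ?gword_sigmaw // /gword /= ij.
  + have xn' : gword (Kn n) (sigmaw (i, j) (sigmaw (i, j) x)) by rewrite !gword_sigmaw.
    have := w2 r _ y xn' rn yn.
    by rewrite E /insertion !big_cons big_nil /= !scale1r addr0.
- have /and4P[iN jN kN /andP[lN _]] := L.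
  have /and5P[ij ik il jk /andP[jl kl]] : [&& i != j, i != k, i != l, j != k, j != l & k != l].
    by move: (U); rewrite /= !inE !negb_or -!andbA andbT.
  rewrite E /insertion !big_cons big_nil /= !copsum_cons !scale1r addr0 !scalerDr
    -!copsum_scale -!copsum_add.
  (* Both letters on the left, both on the right, then two mixed pairs; these cancel exactly because
     each transposition fixes the letters of the other. *)
  apply: copsum_Kn => // x y xn yn; rewrite !addrA (ACl ((1*5)*(4*8)*(2*7)*(3*6)))/=.
  rewrite (@tpermD i j k) 1?(@tpermD i j l) 1?(@tpermD k l i) 1?(@tpermD k l j) //;
    try by rewrite eq_sym.
  rewrite !scaleN1r !subrr !addr0; apply: (WD).
  + have := w1 r x y yn rn xn.
    by rewrite E /insertion !big_cons big_nil /= !scale1r !scaleN1r addr0.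
  + have xn' : gword (Kn n) (sigmaw (i, j) (sigmaw (k, l) x))
      by rewrite !gword_sigmaw // /Kn ?iN ?jN ?kN ?lN.
    have := w2 r _ y xn' rn yn.
    rewrite E /insertion !big_cons big_nil /= !scale1r !scaleN1r addr0.
    by rewrite [in X in _ - X](@eq_sigmaw2 (i, j) (k, l) (k, l) (i, j)) // => p; apply: tperm_commute.
- have /and4P[iN jN kN _] := L.
  have /and3P[ij ik jk] : [&& i != j, i != k & j != k].
    by move: (U); rewrite /= !inE !negb_or -!andbA andbT.
  have Uj : uniq [:: j; k; i] by rewrite -(rot_uniq 2).
  rewrite E /insertion !big_cons big_nil /= !copsum_cons !scale1r addr0 -!copsum_add.
  apply: copsum_Kn => // x y xn yn.
  (* Both letters on the left, both on the right, then three mixed pairs; the members of a pair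
     differ only by having opposite generators at the head of the first factor. *)
  rewrite !addrA (ACl ((1*5*9)*(4*8*12)*(2*7)*(3*10)*(6*11)))/=.
  rewrite !(tpermE1, tpermE2) (@tpermD i j k) 1?(@tpermD j k i) 1?(@tpermD k i j) //;
    try by rewrite eq_sym.
  apply: (WD); first apply: (WD); first apply: (WD); first apply: (WD).
  + have := w1 r x y yn rn xn.
    by rewrite E /insertion !big_cons big_nil /= !scale1r addr0 !addrA.
  + have xn' : gword (Kn n) (sigmaw (i, j) (sigmaw (j, k) x))
      by rewrite !gword_sigmaw // /Kn ?iN ?jN ?kN.
    have := w2 r _ y xn' rn yn.
    rewrite E /insertion !big_cons big_nil /= !scale1r addr0 !addrA.
    (* The three products of two transpositions are one 3-cycle, so the terms with both letters on
       the right share their first factor. *)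
    have -> : sigmaw (k, i) (sigmaw (i, j) x) = sigmaw (i, j) (sigmaw (j, k) x).
      by rewrite (eq_sigmaw2 (c := (k, i)) (d := (i, j))) // => p;
        rewrite (tperm_cycle p U) (tperm_cycle p Uj).
    by rewrite [sigmaw (j, k) (sigmaw (k, i) x)](@eq_sigmaw2 (j, k) (k, i) (i, j) (j, k)) // => p;
      rewrite (tperm_cycle p U).
  + by apply: anti; rewrite ?gword_sigmaw /gword /= /Kn /= ?iN ?jN ?kN // ?[k == i]eq_sym ?ij ?jk ?ik.
  + by apply: anti; rewrite ?gword_sigmaw /gword /= /Kn /= ?iN ?jN ?kN // ?[k == i]eq_sym ?ij ?jk ?ik.
  + by apply: anti; rewrite ?gword_sigmaw /gword /= /Kn /= ?iN ?jN ?kN // ?[k == i]eq_sym ?ij ?jk ?ik.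
Qed.
End CopsumRespects.

(** Peeling a letter off the left context [u] replaces [f] by the two maps of [copsum_cons], which
    are again of the same kind; hence the induction runs over all [f]. *)
Lemma copsum_respects n (V : lmodType rat) (W : V -> Prop) f : subspace W ->
  birespects n W f -> respects n W (copsum f).
Proof.
move=> sW Wf u r v; elim: u f Wf => [|a u IH] f Wf un vn rn.
  exact: (copsum_fk_rel sW Wf rn vn).
case/andP: un => an un; rewrite /insertion.
under eq_bigr do rewrite /= copsum_cons scalerDr.
rewrite big_split /=; case: (sW) => _ WD _; apply: (WD); apply: IH => //.
  exact: birespects_left.
exact: birespects_right.
Qed.

(** * Projections along subspaces *)

Definition wspan (P : word -> Prop) : FA -> Prop :=
  linspan (fun v => exists2 w, P w & v = e w).

Lemma wspan_e (P : word -> Prop) w : P w -> wspan P (e w).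
Proof. by move=> Pw; apply: linspan_gen; exists w. Qed.

Lemma wspan_lin (P : word -> Prop) (W : lmodType rat) (f : {linear FA -> W}) B v :
  subspace B -> (forall w, P w -> B (f (e w))) -> wspan P v -> B (f v).
Proof. by move=> sB PB; apply: linspan_lin v => // _ [w Pw ->]; apply: PB. Qed.

Lemma wspan_min (P : word -> Prop) (B : FA -> Prop) v : subspace B ->
  (forall w, P w -> B (e w)) -> wspan P v -> B v.
Proof. by move=> sB PB; apply: linspan_min v => // _ [w Pw ->]; apply: PB. Qed.

Lemma wspan_sub (P Q : word -> Prop) v : (forall w, P w -> Q w) -> wspan P v -> wspan Q v.
Proof. by move=> PQ; apply: linspan_sub => _ [w /PQ Qw ->]; exists w. Qed.

Lemma subspace_kernel (V W : lmodType rat) (f : {linear V -> W}) : subspace (fun v => f v = 0).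
Proof. exact: subspace_preim (subspace_eq0 W). Qed.

Lemma wspan_kernel (P : word -> Prop) (W : lmodType rat) (f : word -> W) v :
  (forall w, P w -> f w = 0) -> wspan P v -> lin f v = 0.
Proof.
move=> Pf; apply: (wspan_lin (B := fun x => x = 0)); first exact: subspace_eq0.
by move=> w Pw; rewrite linE Pf.
Qed.

Lemma eq_lin_wspan (P : word -> Prop) (W : lmodType rat) (f g : word -> W) v :
  (forall w, P w -> f w = g w) -> wspan P v -> lin f v = lin g v.
Proof.
move=> fg; apply: (wspan_min (B := fun v => lin f v = lin g v)) => [|w Pw].
  split=> [|u w fu fw|c w fw]; first by rewrite !linear0.
    by rewrite !linearD fu fw.
  by rewrite !linearZ fw.
by rewrite !linE fg.
Qed.

Section ComplementProjection.
Variable S : FA -> Prop.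
Hypothesis sS : subspace S.

Lemma wspan_cons w0 (ws : seq word) v : wspan (fun w => w \in w0 :: ws) v ->
  exists c v', wspan (fun w => w \in ws) v' /\ v = c *: e w0 + v'.
Proof.
apply: (wspan_min (B := fun v => exists c v', _ /\ v = c *: e w0 + v')) => [|w].
  split=> [|u x [c [u' [su ->]]] [d [v' [sv ->]]]|d x [c [v' [sv ->]]]].
  - by exists 0, 0; rewrite scale0r addr0; split=> //; apply: linspan0.
  - exists (c + d), (u' + v'); split; first exact: linspanD.
    by rewrite scalerDl addrACA.
  - by exists (d * c), (d *: v'); rewrite scalerDr scalerA; split=> //; apply: linspanZ.
rewrite inE => /orP[/eqP ->|ww].
  by exists 1, 0; rewrite scale1r addr0; split=> //; apply: linspan0.
by exists 0, (e w); rewrite scale0r add0r; split=> //; apply: wspan_e.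
Qed.

(** Elimination, one word at a time: a word congruent modulo [S] to a combination of earlier ones is
    sent to the image of that combination; any other word is kept as a new vector of the
    complement. *)
Lemma complement_projection (ws : seq word) : exists pi : word -> FA,
  [/\ forall w, w \notin ws -> pi w = 0,
      forall w, w \in ws -> S (e w - pi w),
      forall w, wspan (fun w => w \in ws) (pi w) &
      forall v, wspan (fun w => w \in ws) v -> S v -> lin pi v = 0].
Proof.
elim: ws => [|w0 ws [pi [pi0 piS piW piK]]].
  exists (fun => 0); split=> // [w|v]; first exact: linspan0.
  by move=> sv _; apply: wspan_kernel sv.
have [w0s|w0s] := boolP (w0 \in ws).
  have Es w : (w \in w0 :: ws) = (w \in ws) by rewrite inE; case: eqP => // ->.
  exists pi; split=> [w|w|w|v].
  - by rewrite Es; apply: pi0.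
  - by rewrite Es; apply: piS.
  - by apply: wspan_sub (piW w) => x; rewrite Es.
  - by move=> sv; apply: piK; apply: wspan_sub sv => x; rewrite Es.
have [S0 SD SZ] := sS.
have ext x : exists2 pi' : word -> FA, pi' w0 = x & forall w, w != w0 -> pi' w = pi w.
  by exists (fun w => if w == w0 then x else pi w) => [|w /negbTE ->]; rewrite ?eqxx.
have neq w : w \in ws -> w != w0 by apply: contraTneq => ->.
have widen v : wspan (fun w => w \in ws) v -> wspan (fun w => w \in w0 :: ws) v.
  by apply: wspan_sub => w ww; rewrite inE ww orbT.
have [[v' [sv' Sv']]|nodep] := classic (exists v', wspan (fun w => w \in ws) v' /\ S (e w0 - v')).
  have [pi' pi'0 pi'E] := ext (lin pi v').
  have linE' v : wspan (fun w => w \in ws) v -> lin pi' v = lin pi v.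
    by apply: eq_lin_wspan => w /neq /pi'E.
  have linW v : wspan (fun w => w \in ws) (lin pi v).
    have [P ->] := toFP v; rewrite lin_toF; apply: subspace_sum => [|t _].
      exact: linspan_subspace.
    by apply: linspanZ; apply: piW.
  exists pi'; split=> [w|w|w|v].
  - by rewrite inE negb_or => /andP[/pi'E -> /pi0].
  - rewrite inE => /orP[/eqP ->|ww]; last by rewrite pi'E ?neq //; apply: piS.
    rewrite pi'0 -(subrK v' (e w0)) -addrA; apply: SD => //.
    rewrite -{1}[v']lin_id -[X in S X]/(_ - _).
    have -> : lin e v' - lin pi v' = lin (fun w => e w - pi w) v'.
      have [P ->] := toFP v'; rewrite !lin_toF -sumrB.
      by apply: eq_bigr => t _; rewrite scalerBr.
    by apply: wspan_lin sv' => // x xs; rewrite linE; apply: piS.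
  - by case: (eqVneq w w0) => [->|/pi'E ->]; rewrite ?pi'0; apply: widen.
  - move=> /wspan_cons[c [u [su ->]]] Su.
    rewrite linearD linearZ /= linE pi'0 linE' // -linearZ -linearD; apply: piK.
      by apply: linspanD => //; apply: linspanZ.
    have := subspaceB sS Su (SZ c _ Sv'); congr S.
    by rewrite scalerBr opprB addrC addrA subrK.
have [pi' pi'0 pi'E] := ext (e w0).
exists pi'; split=> [w|w|w|v].
- by rewrite inE negb_or => /andP[/pi'E -> /pi0].
- rewrite inE => /orP[/eqP ->|ww]; first by rewrite pi'0 subrr.
  by rewrite pi'E ?neq //; apply: piS.
- case: (eqVneq w w0) => [->|/pi'E ->]; last exact: widen.
  by rewrite pi'0; apply: wspan_e; rewrite mem_head.
- move=> /wspan_cons[c [u [su ->]]] Su.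
  (* If [c] is nonzero, dividing by it expresses [w0] modulo [S] by the earlier words, against
     [nodep]. *)
  have [c0|cn0] := eqVneq c 0.
    rewrite c0 scale0r add0r in Su *.
    have -> : lin pi' u = lin pi u by apply: eq_lin_wspan su => w /neq /pi'E.
    exact: piK.
  case: nodep; exists (- (c^-1 *: u)); split; first by apply/linspanN/linspanZ.
  by have := SZ c^-1 _ Su; rewrite scalerDr scalerA mulVf // scale1r opprK.
Qed.
End ComplementProjection.

Section Coefficients.

Definition coefF (x : word) : {linear FA -> rat^o} := lin (fun w => (w == x)%:R : rat^o).

Lemma coefF_toF x P : coefF x (toF P) = coef P x.
Proof.
rewrite /coefF lin_toF /coef [RHS]big_mkcond; apply: eq_bigr => t _.
by case: eqP => _; rewrite /GRing.scale /= ?mulr1 ?mulr0.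
Qed.

Lemma coefF_eq0 v : (forall x, coefF x v = 0) -> v = 0.
Proof.
have [P ->] := toFP v.
suff E : toF P = \sum_(x <- undup (unzip2 P)) (coefF x (toF P) : rat) *: e x.
  by move=> c0; rewrite E big1 // => x _; rewrite c0 scale0r.
have : {subset unzip2 P <= undup (unzip2 P)} by move=> x; rewrite mem_undup.
move: (undup_uniq (unzip2 P)); move: (undup _) => s us.
rewrite /toF; elim: P => [_|t P IH sub].
  by rewrite !big_nil big1 // => x _; rewrite linear0 scale0r.
rewrite !big_cons {1}IH; last by move=> x xP; apply: sub; rewrite inE xP orbT.
have ts : t.2 \in s by apply: sub; rewrite mem_head.
rewrite [RHS](eq_bigr (fun x => (coefF x (t.1 *: e t.2) : rat) *: e x +
    (coefF x (\sum_(s <- P) s.1 *: e s.2) : rat) *: e x)) => [|x _]; last first.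
  by rewrite raddfD scalerDl.
rewrite big_split /=; congr (_ + _).
have cE x : coefF x (t.1 *: e t.2) = t.1 * (t.2 == x)%:R by rewrite linearZ /= linE.
rewrite (bigD1_seq t.2) //= big1 ?addr0 => [|x xt]; first by rewrite cE eqxx mulr1.
by rewrite cE eq_sym (negbTE xt) mulr0 scale0r.
Qed.
End Coefficients.

Definition lmul (u : word) : {linear FA -> FA} := lin (fun w => e (u ++ w)).
Definition rmul (u : word) : {linear FA -> FA} := lin (fun w => e (w ++ u)).

Lemma lmulE u w : lmul u (e w) = e (u ++ w).
Proof. exact: linE. Qed.

Lemma rmulE u w : rmul u (e w) = e (w ++ u).
Proof. exact: linE. Qed.

Lemma lmul_cat u w v : lmul (u ++ w) v = lmul u (lmul w v).
Proof.
have [P ->] := toFP v; rewrite /lmul lin_toF lin_toF linear_sum.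
by apply: eq_bigr => t _; rewrite linearZ /= linE catA.
Qed.

Section Graded.
Variable n : nat.

Definition hom d (v : FA) : Prop := wspan (fun w => gword (Kn n) w && (size w == d)) v.

(** Each graded piece is spanned by finitely many words, as [complement_projection] requires. *)
Lemma Kn_words d : exists ws : seq word, forall w,
  (w \in ws) = gword (Kn n) w && (size w == d).
Proof.
pose letters := [seq a <- [seq (i, j) | i <- iota 0 n, j <- iota 0 n] | Kn n a.1 a.2].
have lP a : (a \in letters) = Kn n a.1 a.2.
  rewrite mem_filter andb_idr // => /and3P[a1 a2 _].
  by apply/allpairsP; exists a; rewrite !mem_iota; case: a a1 a2.
elim: d => [|d [ws wsP]].
  by exists [:: [::]] => -[|a w]; rewrite inE ?andbF.
exists [seq a :: w | a <- letters, w <- ws] => w.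
apply/allpairsP/andP => [[[a x] /= []]|[]].
  by rewrite lP wsP => an /andP[xn xd] ->; rewrite /= an.
case: w => // a w /= /andP[an wn] wd; exists (a, w).
by rewrite lP wsP an wn.
Qed.

Lemma fk_rel_hom r : fk_rel n r ->
  exists d, (0 < d)%N /\ forall t, t \in r -> gword (Kn n) t.2 /\ size t.2 = d.
Proof.
case=> [[i [j [ij ->]]]|[[i [j [ij ->]]]|[[i [j [k [l [U [L ->]]]]]]|[i [j [k [U [L ->]]]]]]]].
- exists 1%N; split=> // t; rewrite !inE => /orP[]/eqP -> /=.
    by rewrite /gword /= ij.
  by rewrite /gword /= Kn_sym ij.
- by exists 2%N; split=> // t; rewrite !inE => /eqP -> /=; rewrite /gword /= ij.
- move: U L; rewrite /= !inE !negb_or -!andbA => /and5P[ij ik il jk /and3P[jl kl _]].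
  move=> /and5P[iN jN kN lN _]; exists 2%N; split=> // t.
  by rewrite !inE => /orP[]/eqP -> /=; rewrite /gword /= /Kn iN jN kN lN ?ij ?kl.
- move: U L; rewrite /= !inE !negb_or -!andbA => /and4P[ij ik jk _] /and4P[iN jN kN _].
  exists 2%N; split=> // t.
  by rewrite !inE => /or3P[]/eqP -> /=; rewrite /gword /= /Kn iN jN kN ?ij ?jk // eq_sym ik.
Qed.

Lemma insertion_hom u r v : gword (Kn n) u -> gword (Kn n) v -> fk_rel n r ->
  exists d, (0 < d)%N /\ hom d (insertion e u r v).
Proof.
move=> un vn /fk_rel_hom[d [d0 rd]]; exists (size u + (d + size v))%N.
split; first by rewrite addn_gt0 addn_gt0 d0 orbT.
apply: subspace_sum => [|t /rd[tn td]]; first exact: linspan_subspace.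
apply: linspanZ; apply: wspan_e; rewrite !size_cat td eqxx andbT.
by rewrite /gword !all_cat; apply/and3P; split.
Qed.

(** A projection built in degree [D] alone, and zero in other degrees, kills the whole span of [A]:
    the homogeneous generators of degree [D] by construction, the others trivially. *)
Lemma graded_projection D (A : FA -> Prop) : (forall v, A v -> exists d, hom d v) ->
  exists pi : word -> FA,
  [/\ forall w, ~~ (gword (Kn n) w && (size w == D)) -> pi w = 0,
      forall w, gword (Kn n) w -> size w = D -> linspan A (e w - pi w),
      forall w, hom D (pi w) &
      forall v, linspan A v -> lin pi v = 0].
Proof.
move=> Ah; have [ws wsP] := Kn_words D.
have [pi [pi0 piS piW piK]] := complement_projection (linspan_subspace A) ws.
have homW v : wspan (fun w => w \in ws) v <-> hom D v.
  by split; apply: wspan_sub => w; rewrite wsP.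
exists pi; split=> [w wD|w wn wD|w|].
- by apply: pi0; rewrite wsP.
- by apply: piS; rewrite wsP wn wD eqxx.
- exact/homW.
apply: linspan_min => [|v Av]; first exact: subspace_kernel.
have [d vd] := Ah v Av; have [dD|dD] := eqVneq d D.
  by apply: piK (linspan_gen Av); apply/homW; rewrite -dD.
apply: wspan_kernel vd => w /andP[_ /eqP wd]; apply: pi0.
by rewrite wsP wd (negbTE dD) andbF.
Qed.
End Graded.

(** * The subspaces [E_H^+ E_G] *)

(** One leading letter of [H] is enough: when [H] lies in [G], the other letters of a word of E_H^+
    are absorbed by the factor in E_G. The relators turn the span into a full preimage. *)
Definition prodgen n (H G : rel nat) (v : FA) : Prop :=
  (exists a w, [/\ H a.1 a.2, gword G w & v = e (a :: w)]) \/ relator n v.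

(* the preimage of [E_H^+ E_G] in the free algebra *)
Definition prodspan n (H G : rel nat) : FA -> Prop := linspan (prodgen n H G).

Lemma gword_sub (G G' : rel nat) w : (forall i j, G i j -> G' i j) -> gword G w -> gword G' w.
Proof. by move=> GG; apply: sub_all => a; apply: GG. Qed.

Lemma gword_cat (G : rel nat) u v : gword G (u ++ v) = gword G u && gword G v.
Proof. exact: all_cat. Qed.

Lemma ideal_prodspan n H G v : ideal n v -> prodspan n H G v.
Proof. by apply: linspan_sub => w wI; right. Qed.

Lemma ideal_lmul n u v : gword (Kn n) u -> ideal n v -> ideal n (lmul u v).
Proof.
move=> un; apply: lin_ideal; first exact: linspan_subspace.
move=> u' r v' un' vn' rn; apply: linspan_gen; exists (u ++ u'), r, v'.
by split=> //; rewrite ?gword_cat ?un //; apply: eq_bigr => t _; rewrite -!catA.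
Qed.

Lemma relator_hom n v : relator n v -> exists d, (0 < d)%N /\ hom n d v.
Proof. by move=> [u [r [w [un wn rn ->]]]]; apply: insertion_hom. Qed.

Lemma copsum_top (V : lmodType rat) (f : word -> word -> V) w :
  (forall x y, (size y < size w)%N -> f x y = 0) -> copsum f w = f [::] w.
Proof.
elim: w f => [|a w IH] f f0; first exact: copsum_nil.
rewrite copsum_cons [X in X + _](_ : _ = 0) ?add0r; first by rewrite IH // => x y yw; apply: f0.
apply: (copsum_in (P := fun x y => (size y <= size w)%N) (A := fun z => z = 0)).
- exact: subspace_eq0.
- elim: w {IH f0} => [|b w IH] s; first by rewrite inE => /eqP ->.
  by rewrite mem_cat => /orP[] /mapP[t /IH tw ->] //=; apply: leqW.
- by move=> x y yw; apply: f0.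
Qed.

Lemma size_cop w s : s \in cop w -> (size s.1.2 + size s.2)%N = size w.
Proof.
elim: w s => [|b w IH] s; first by rewrite inE => /eqP ->.
by rewrite mem_cat => /orP[] /mapP[t /IH tw ->] /=; rewrite ?size_sigmaw ?addnS -tw.
Qed.

Lemma gword_cop2 (G : rel nat) w s : s \in cop w -> gword G w -> gword G s.2.
Proof.
elim: w s => [|b w IH] s; first by rewrite inE => /eqP ->.
rewrite mem_cat => /orP[] /mapP[t /IH tw ->] /= /andP[bG /tw tG] //=.
by rewrite bG.
Qed.

Section Intersection.
Variables (n : nat) (G H : rel nat).
Hypothesis GK : forall i j, G i j -> Kn n i j.
Hypothesis HG : forall i j, H i j -> G i j.

(** A filtration of E_H^+ E_n by the length of the tail [w] that may leave [G]: level 0 is E_H^+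
    E_G, and the union of the levels is E_H^+ E_n. *)
Definition tailgen D (v : FA) : Prop :=
  (exists a u w, [/\ H a.1 a.2, gword G u, gword (Kn n) w, (size w <= D)%N & v = e (a :: u ++ w)])
  \/ relator n v.

Lemma tailgenS D v : linspan (tailgen D) v -> linspan (tailgen D.+1) v.
Proof.
apply: linspan_sub => x [[a [u [w [aH uG wn wD ->]]]]|]; last by right.
by left; exists a, u, w; split=> //; apply: leqW.
Qed.

Lemma tailgen_le D D' v : (D <= D')%N -> linspan (tailgen D) v -> linspan (tailgen D') v.
Proof.
by move=> /subnK <- Dv; elim: (D' - D)%N => [|k IH] //; rewrite addSn; apply: tailgenS.
Qed.

Lemma prodspan_tailgen v : prodspan n H (Kn n) v -> exists D, linspan (tailgen D) v.
Proof.
apply: (linspan_min (B := fun v => exists D, linspan (tailgen D) v)).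
  split=> [|u w [D Du] [D' Dw]|c w [D Dw]].
  - by exists 0%N; apply: linspan0.
  - exists (maxn D D'); apply: linspanD; [apply: tailgen_le Du|apply: tailgen_le Dw].
      exact: leq_maxl.
    exact: leq_maxr.
  - by exists D; apply: linspanZ.
move=> x [[a [w [aH wK ->]]]|rv]; last by exists 0%N; apply: linspan_gen; right.
by exists (size w); apply: linspan_gen; left; exists a, [::], w.
Qed.

Lemma tailgen0 v : linspan (tailgen 0) v -> prodspan n H G v.
Proof.
apply: linspan_sub => x [[a [u [w [aH uG _]]]]|]; last by right.
by rewrite leqn0 size_eq0 => /eqP -> ->; left; exists a, u; rewrite cats0.
Qed.

Definition headgen D (v : FA) : Prop :=
  (exists a w, [/\ G a.1 a.2, gword (Kn n) w, size w = D & v = e (a :: w)]) \/ relator n v.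

Lemma headgen_hom D v : headgen D v -> exists d, hom n d v.
Proof.
case=> [[a [w [aG wn wD ->]]]|/relator_hom[d [_ vd]]]; last by exists d.
by exists D.+1; apply: wspan_e; rewrite /= wD eqxx andbT /gword /= GK.
Qed.

(* The E_G-linear map [Q |-> sum Q1 pi(Q2)], with [pi] the projection in degree D+1 along
   E_G^+ E_n, vanishes on E_G; this trades tails of degree D+1 for tails of degree D. *)
Lemma tail_reduction D v : wspan (gword G) v -> linspan (tailgen D.+1) v -> linspan (tailgen D) v.
Proof.
have [pi [pi0 piS piW piK]] := graded_projection D.+1 (@headgen_hom D).
pose f x y := lmul x (pi y).
have relr : respects n (ideal n) (copsum f).
  apply: copsum_respects; first exact: linspan_subspace.
  split=> [y _|x _] u r w un wn rn.
    rewrite /insertion /f -(lin_sumZ _ _ (fun t z => e ((u ++ t.2 ++ w) ++ z))).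
    apply: (wspan_lin _ _ (piW y)) => [|z /andP[zn _]]; first exact: linspan_subspace.
    rewrite linE; apply: linspan_gen; exists u, r, (w ++ z).
    by split=> //; rewrite ?gword_cat ?wn //; apply: eq_bigr => t _; rewrite -!catA.
  rewrite /insertion /f; under eq_bigr do rewrite -linearZ.
  rewrite -linear_sum -/(insertion pi u r w) -lin_insertion piK ?linear0; first exact: linspan0.
  by apply: linspan_gen; right; exists u, r, w.
pose S := lin (copsum f).
have S_ideal z : ideal n z -> ideal n (S z) by apply: lin_ideal; first exact: linspan_subspace.
have pi_head g w : G g.1 g.2 -> gword (Kn n) w -> pi (g :: w) = 0.
  move=> gG wn; have [wD|wD] := eqVneq (size w) D; last first.
    by apply: pi0; rewrite /= eqSS (negbTE wD) andbF.
  by rewrite -linE; apply: piK; apply: linspan_gen; left; exists g, w.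
(* The terms with [g] in the second factor vanish because [pi] kills E_G^+ E_n; this is the left
   E_G-linearity of [S]. *)
have S_cons g w : G g.1 g.2 -> gword (Kn n) w -> S (e (g :: w)) = lmul [:: g] (S (e w)).
  move=> gG wn; rewrite !linE copsum_cons [X in _ + X](_ : _ = 0) ?addr0.
    by rewrite copsum_lin; apply: copsum_ext => x y; rewrite /f -lmul_cat.
  apply: (copsum_Kn (W := fun z => z = 0)) wn _; first exact: subspace_eq0.
  by move=> x y _ yn; rewrite /f pi_head // linear0.
have S_cat u w : gword G u -> gword (Kn n) w -> S (e (u ++ w)) = lmul u (S (e w)).
  move=> uG wn; elim: u uG => [_|g u IH /= /andP[gG uG]].
    by rewrite /lmul (lin_ext (g := e)) // lin_id.
  rewrite S_cons // ?gword_cat ?wn ?(gword_sub GK uG) // IH // -lmul_cat.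
  by [].
have S0 w : (size w <= D)%N -> S (e w) = 0.
  move=> wD; rewrite linE; apply: (copsum_in (A := fun z => z = 0)
    (P := fun x y => (size y <= D)%N)); first exact: subspace_eq0.
    by move=> s /size_cop sw; apply: leq_trans wD; rewrite -sw leq_addl.
  move=> x y yD; rewrite /f pi0 ?linear0 //.
  by rewrite negb_and orbC neq_ltn ltnS yD.
have S_top w : size w = D.+1 -> S (e w) = pi w.
  move=> wD; rewrite linE copsum_top => [|x y].
    by rewrite /f /lmul (lin_ext (g := e)) // lin_id.
  rewrite wD ltnS => yD; rewrite /f pi0 ?linear0 //.
  by rewrite negb_and orbC neq_ltn ltnS yD.
(* A word of [G] is itself times the empty word, and [S] kills the empty word. *)
move=> vG vD; have Sv : S v = 0.
  apply: (wspan_lin (B := fun z => z = 0)) vG; first exact: subspace_eq0.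
  by move=> w wG; rewrite -[w]cats0 S_cat // S0 // linear0.
(* It remains to shorten the tails of [z - S z] for each generator [z]. *)
rewrite -[v]subr0 -Sv.
apply: (linspan_min (B := fun z => linspan (tailgen D) (z - S z))) vD.
  split=> [|x y xD yD|c x xD].
  - by rewrite linear0 subr0; apply: linspan0.
  - by rewrite linearD opprD addrACA; apply: linspanD.
  - by rewrite linearZ -scalerBr; apply: linspanZ.
move=> x [[a [u [w [aH uG wn wD ->]]]]|xr]; last first.
  apply: linspanB; first by apply: linspan_gen; right.
  by apply: linspan_sub (S_ideal _ (linspan_gen xr)) => y yr; right.
have auG : gword G (a :: u) by rewrite /= HG.
have aun := gword_sub GK auG.
rewrite -cat_cons S_cat //; move: wD; rewrite leq_eqVlt ltnS => /orP[/eqP wD|wD]; last first.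
  by rewrite S0 // linear0 subr0; apply: linspan_gen; left; exists a, u, w.
(* Here [z - S z] is a u (w - pi w), and w - pi w lies in E_G^+ E_n: the letter of [G] heading each
   of its terms joins [u], which leaves a tail of length [D]. *)
rewrite S_top // -lmulE -linearB.
apply: (linspan_lin (linspan_subspace _) _ (piS w wn wD)).
move=> y [[g [z [gG zn zD ->]]]|yr]; last first.
  apply: linspan_sub (ideal_lmul aun (linspan_gen yr)) => z zr; by right.
apply: linspan_gen; left; exists a, (u ++ [:: g]), z; split; rewrite ?zD //.
  by rewrite gword_cat uG /= gG.
by rewrite lmulE /= -catA.
Qed.

Lemma prodspan_inter v : wspan (gword G) v -> prodspan n H (Kn n) v -> prodspan n H G v.
Proof.
move=> vG /prodspan_tailgen[D vD]; apply: tailgen0; elim: D vD => // D IH vD.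
exact/IH/tail_reduction.
Qed.
End Intersection.

Lemma prodgen_hom n (H G : rel nat) v : (forall i j, H i j -> Kn n i j) ->
  (forall i j, G i j -> Kn n i j) -> prodgen n H G v -> exists d, hom n d v.
Proof.
move=> HK GK [[a [w [aH wG ->]]]|/relator_hom[d [_ vd]]]; last by exists d.
exists (size w).+1; apply: wspan_e.
by rewrite /= eqxx andbT /gword /= HK //; apply: (gword_sub GK).
Qed.

(** The functional is a nonzero coordinate of the projection of [v] along E_H^+ E_n; projecting in
    degree [D] only makes it homogeneous. *)
Lemma separating_functional n (H : rel nat) D v : (forall i j, H i j -> Kn n i j) ->
  hom n D v -> ~ prodspan n H (Kn n) v -> exists psi : word -> rat,
  [/\ forall w, size w != D -> psi w = 0,
      forall x, prodspan n H (Kn n) x -> lin (psi : word -> rat^o) x = 0 &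
      lin (psi : word -> rat^o) v != 0].
Proof.
move=> HK vD vL.
have [pi [pi0 piS _ piK]] := graded_projection D (fun v => prodgen_hom HK (fun _ _ => id)).
have piv : lin pi v <> 0.
  move=> pv; case: vL; rewrite -[v]subr0 -pv -{1}[v]lin_id.
  have -> : lin e v - lin pi v = lin (fun w => e w - pi w) v.
    have [P ->] := toFP v; rewrite !lin_toF -sumrB.
    by apply: eq_bigr => t _; rewrite scalerBr.
  apply: (wspan_lin (linspan_subspace _) _ vD) => w /andP[wn /eqP wD].
  by rewrite linE; apply: piS.
have [x vx] : exists x, coefF x (lin pi v) != 0.
  apply: NNPP => nx; apply: piv; apply: coefF_eq0 => x; apply/eqP/negPn/negP => cx.
  by apply: nx; exists x.
have psiE y : lin (fun w => coefF x (pi w)) y = coefF x (lin pi y).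
  have [P ->] := toFP y; rewrite !lin_toF linear_sum.
  by apply: eq_bigr => t _; rewrite linearZ.
exists (fun w => coefF x (pi w)); split=> [w wD|y yL|]; rewrite ?psiE //.
  by rewrite pi0 ?linear0 // (negbTE wD) andbF.
by rewrite piK ?linear0.
Qed.

(** * Contraction by functionals *)

Definition pact (y : word) (i : nat) : nat := foldr tperm i y.
Definition lact (y : word) (b : letter) : letter := (pact y b.1, pact y b.2).

Lemma pact_cat u v i : pact (u ++ v) i = pact u (pact v i).
Proof. by rewrite /pact foldr_cat. Qed.

Lemma pact_rev u i : pact (rev u) (pact u i) = i.
Proof.
elim: u => [|a u IH] //=; rewrite rev_cons -cats1 pact_cat /=.
by rewrite [tperm a _]tpermK IH.
Qed.

Lemma Kn_lact n y b : gword (Kn n) y -> Kn n (lact y b).1 (lact y b).2 = Kn n b.1 b.2.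
Proof. by elim: y => [|a y IH] //= /andP[an yn]; rewrite Kn_tperm ?IH. Qed.

(** The recursion for the coproduct from the right end of a word: in the braided product, a letter
    [a] joining the first factor passes the second factor [y], whose permutation acts on it. *)
Lemma copsum_rcons (V : lmodType rat) (f : word -> word -> V) w a :
  copsum f (rcons w a) =
  copsum (fun x y => f (rcons x (lact y a)) y) w + copsum (fun x y => f x (rcons y a)) w.
Proof.
elim: w f => [|b w IH] f.
  by rewrite /= copsum_cons !copsum_nil /=; case: a.
rewrite rcons_cons !copsum_cons !IH addrACA; congr (_ + _ + (_ + _)).
by apply: copsum_ext => x y; rewrite /sigmaw map_rcons.
Qed.

Lemma fk_rel_pact n r t s : fk_rel n r -> t \in r -> s \in r -> pact t.2 =1 pact s.2.
Proof.
have sym i j : tperm (i, j) =1 tperm (j, i).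
  by move=> p; rewrite /tperm /=; case: (eqVneq p i) => [->|]; case: eqVneq => // ->.
case=> [[i [j [ij ->]]]|[[i [j [ij ->]]]|[[i [j [k [l [U [L ->]]]]]]|[i [j [k [U [L ->]]]]]]]];
  rewrite !inE.
- by move=> /orP[]/eqP -> /orP[]/eqP -> p //=; rewrite sym.
- by move=> /eqP -> /eqP ->.
- have cm p := tperm_commute p U.
  by move=> /orP[]/eqP -> /orP[]/eqP -> p //=; rewrite cm.
- have Uj : uniq [:: j; k; i] by rewrite -(rot_uniq 2).
  have c1 p := tperm_cycle p U; have c2 p := tperm_cycle p Uj.
  by move=> /or3P[]/eqP -> /or3P[]/eqP -> p //=; rewrite ?c1 ?c2.
Qed.

Section Contraction.
Variables (n : nat) (G H : rel nat).
Hypothesis GK : forall i j, G i j -> Kn n i j.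
Hypothesis HG : forall i j, H i j -> G i j.

Let HK i j : H i j -> Kn n i j. Proof. by move/HG/GK. Qed.
Let L := prodspan n H (Kn n).
Let K := prodspan n H G.

(* A family of functionals on E_n/(E_H^+ E_n) indexed by S_n: [Phi x y] depends on [y] only
   through its S_n-degree. *)
Definition dual_family (Phi : word -> word -> rat) : Prop :=
  [/\ forall y v, gword (Kn n) y -> L v -> lin (Phi^~ y : word -> rat^o) v = 0,
      forall x y y', pact y =1 pact y' -> Phi x y = Phi x y' &
      exists D, forall x y, (D < size x)%N -> Phi x y = 0].

(** The operator T_Phi, on the free algebra. *)
Definition contract (Phi : word -> word -> rat) : {linear FA -> FA} :=
  lin (copsum (fun x y => Phi x y *: e y)).

Lemma dual_family_scale c Phi : dual_family Phi -> dual_family (fun x y => c * Phi x y).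
Proof.
move=> [kill perm [D bound]]; split=> [y v yn vL|x y y' yy|].
- rewrite (_ : lin _ v = c *: (lin (Phi^~ y : word -> rat^o) v)).
    by rewrite kill // scaler0.
  have [P ->] := toFP v; rewrite !lin_toF scaler_sumr.
  by apply: eq_bigr => t _; rewrite /GRing.scale /= mulrCA.
- by rewrite (perm x y y').
- by exists D => x y /bound ->; rewrite mulr0.
Qed.

Lemma dual_family_add Phi Psi : dual_family Phi -> dual_family Psi ->
  dual_family (fun x y => Phi x y + Psi x y).
Proof.
move=> [kill perm [D bound]] [kill' perm' [D' bound']]; split=> [y v yn vL|x y y' yy|].
- rewrite (_ : lin _ v = lin (Phi^~ y : word -> rat^o) v + lin (Psi^~ y : word -> rat^o) v).
    by rewrite kill // kill' // addr0.
  have [P ->] := toFP v; rewrite !lin_toF -big_split.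
  by apply: eq_bigr => t _; rewrite scalerDr.
- by rewrite (perm x y y') // (perm' x y y').
- by exists (maxn D D') => x y; rewrite gtn_max => /andP[/bound -> /bound' ->]; rewrite addr0.
Qed.

Lemma dual_family0 : dual_family (fun _ _ => 0).
Proof.
split=> //; last by exists 0%N.
move=> y v _ _; have [P ->] := toFP v; rewrite lin_toF big1 // => t _.
exact: mulr0.
Qed.

Lemma dual_family_constant psi D :
  (forall w, size w != D -> psi w = 0) ->
  (forall x, L x -> lin (psi : word -> rat^o) x = 0) -> dual_family (fun x _ => psi x).
Proof.
move=> psiD psiL; split=> [y v _|//|]; first exact: psiL.
by exists D => x _ xD; apply: psiD; rewrite neq_ltn xD orbT.
Qed.

Lemma dual_family_rcons a Phi : Kn n a.1 a.2 -> dual_family Phi ->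
  dual_family (fun x y => Phi x (rcons y a)).
Proof.
move=> an [kill perm [D bound]]; split=> [y v yn vL|x y y' yy|].
- by apply: kill => //; rewrite /gword all_rcons an.
- by apply: perm => i; rewrite -!cats1 !pact_cat.
- by exists D => x y; apply: bound.
Qed.

Lemma L_rmul u v : gword (Kn n) u -> L v -> L (rmul u v).
Proof.
move=> un; apply: linspan_lin; first exact: linspan_subspace.
move=> x [[a [w [aH wn ->]]]|[u' [r [w [un' wn rn ->]]]]]; apply: linspan_gen.
  by left; exists a, (w ++ u); rewrite rmulE gword_cat wn.
right; exists u', r, (w ++ u); split; rewrite ?gword_cat ?wn //.
rewrite linear_sum; apply: eq_bigr => t _.
by rewrite linearZ /= linE -!catA.
Qed.

(** [L] is stable under right multiplication, so one more letter at the right of the first argument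
    does no harm; that letter depends on [y] only through its permutation. *)
Lemma dual_family_twist a Phi : Kn n a.1 a.2 -> dual_family Phi ->
  dual_family (fun x y => Phi (rcons x (lact y a)) (rcons y a)).
Proof.
move=> an [kill perm [D bound]]; split=> [y v yn vL|x y y' yy|].
- rewrite (_ : lin _ v = lin (Phi^~ (rcons y a) : word -> rat^o) (rmul [:: lact y a] v)).
    apply: kill; first by rewrite /gword all_rcons an.
    by apply: L_rmul; rewrite //= /gword /= andbT Kn_lact.
  have [P ->] := toFP v; rewrite !lin_toF !linear_sum.
  by apply: eq_bigr => t _; rewrite !linearZ /= !linE cats1.
- by rewrite /lact !yy; apply: perm => i; rewrite -!cats1 !pact_cat.
- by exists D => x y xD; apply: bound; rewrite size_rcons; apply: leqW.
Qed.

(** From [copsum_rcons]: in its second sum the family is evaluated at y a a, which has the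
    S_n-degree of y since a transposition is an involution. *)
Lemma contract_rmul a Phi v : dual_family Phi ->
  contract (fun x y => Phi x (rcons y a)) (rmul [:: a] v) =
  contract (fun x y => Phi (rcons x (lact y a)) (rcons y a)) v + rmul [:: a] (contract Phi v).
Proof.
move=> [_ perm _]; have [P ->] := toFP v; rewrite !linear_sum -big_split.
apply: eq_bigr => t _ /=; rewrite !linearZ -scalerDr rmulE !linE cats1 copsum_rcons.
congr (_ *: (_ + _)); rewrite copsum_lin; apply: copsum_ext => x y.
rewrite linearZ rmulE cats1; congr (_ *: _); apply: perm => i.
by rewrite -!cats1 !pact_cat /= tpermK.
Qed.

(** A relation in the first factor is killed because the ideal lies in [L]. In the second factor its
    terms share one S_n-degree, so the value of [Phi] factors out and a multiple of the relation is
    left. *)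
Lemma contract_ideal Phi v : dual_family Phi -> ideal n v -> ideal n (contract Phi v).
Proof.
move=> [kill perm _]; apply: lin_ideal; first exact: linspan_subspace.
apply: copsum_respects; first exact: linspan_subspace.
split=> [y yn|x xn] u r w un wn rn.
  rewrite /insertion (eq_bigr (fun t => (t.1 * Phi (u ++ t.2 ++ w) y) *: e y)) => [|t _]; last first.
    by rewrite scalerA.
  rewrite -scaler_suml (_ : \sum_(t <- r) _ = 0) ?scale0r; first exact: linspan0.
  rewrite -[LHS](lin_insertion (Phi^~ y : word -> rat^o)); apply: kill => //.
  by apply: ideal_prodspan; apply: linspan_gen; exists u, r, w.
case: r rn => [|t0 r] rn; first by rewrite /insertion big_nil; apply: linspan0.
have -> : insertion (fun y => Phi x y *: e y) u (t0 :: r) w =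
    Phi x (u ++ t0.2 ++ w) *: insertion e u (t0 :: r) w.
  rewrite /insertion scaler_sumr !big_seq; apply: eq_bigr => t tr.
  rewrite !scalerA mulrC; congr (_ * _ *: _); apply: perm => i.
  by rewrite !pact_cat (fk_rel_pact rn tr (mem_head _ _)).
by apply/linspanZ/linspan_gen; exists u, (t0 :: r), w.
Qed.

Lemma K_rmul u v : gword G u -> K v -> K (rmul u v).
Proof.
move=> uG; apply: linspan_lin; first exact: linspan_subspace.
move=> x [[a [w [aH wn ->]]]|[u' [r [w [un' wn rn ->]]]]]; apply: linspan_gen.
  by left; exists a, (w ++ u); rewrite rmulE gword_cat wn.
right; exists u', r, (w ++ u); split; rewrite ?gword_cat ?wn ?(gword_sub GK uG) //.
rewrite linear_sum; apply: eq_bigr => t _.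
by rewrite linearZ /= linE -!catA.
Qed.

(** For a generator a w with a in [H], the family kills the terms with a in the first factor; the
    others keep a at the head of the second factor, followed by a word of [G]. *)
Lemma contract_K Phi v : dual_family Phi -> K v -> K (contract Phi v).
Proof.
move=> dPhi; have sK := linspan_subspace (prodgen n H G); apply: linspan_lin => // x.
case=> [[a [w [aH wG ->]]]|xr]; last first.
  by apply: ideal_prodspan; apply: contract_ideal => //; apply: linspan_gen.
have [kill _ _] := dPhi.
rewrite linE copsum_cons; apply: linspanD.
  apply: (copsum_Kn sK) => [|x' y xn yn]; first exact: gword_sub GK wG.
  rewrite (_ : Phi (a :: x') y = 0) ?scale0r; first exact: linspan0.
  rewrite -[LHS](linE (Phi^~ y : word -> rat^o)); apply: kill => //.
  by apply: linspan_gen; left; exists a, x'.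
apply: (copsum_in (P := fun _ y => gword G y) sK) => [s sw|x' y yG].
  exact: gword_cop2 sw wG.
by apply/linspanZ/linspan_gen; left; exists a, y.
Qed.
End Contraction.

(** * The top degree modulo [E_H^+ E_G] *)

Definition degpart d : {linear FA -> FA} := lin (fun w => if size w == d then e w else 0).

Lemma degpart_same (P : word -> Prop) d v :
  wspan (fun w => P w /\ size w = d) v -> degpart d v = v.
Proof.
move=> vd; rewrite -[RHS]lin_id; apply: eq_lin_wspan vd => w [_ ->].
by rewrite eqxx.
Qed.

Lemma degpart_other (P : word -> Prop) d v :
  (forall w, P w -> size w != d) -> wspan P v -> degpart d v = 0.
Proof. by move=> Pd; apply: wspan_kernel => w /Pd /negbTE ->. Qed.

Lemma degpart_prodspan n (H G : rel nat) d v : (forall i j, H i j -> Kn n i j) ->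
  (forall i j, G i j -> Kn n i j) -> prodspan n H G v -> prodspan n H G (degpart d v).
Proof.
move=> HK GK; apply: linspan_lin => [|x xg]; first exact: linspan_subspace.
have [d' xd'] := prodgen_hom HK GK xg; have [dd|dd] := eqVneq d' d.
  have -> : degpart d x = x.
    apply: (degpart_same (P := gword (Kn n))); apply: wspan_sub xd' => w.
    by rewrite dd => /andP[? /eqP].
  exact: linspan_gen.
rewrite (degpart_other _ xd'); first exact: linspan0.
by move=> w /andP[_ /eqP ->].
Qed.

Lemma copsum_bottom (V : lmodType rat) (f : word -> word -> V) w :
  (forall x y, (size x < size w)%N -> f x y = 0) -> copsum f w = f w [::].
Proof.
elim: w f => [|a w IH] f f0; first exact: copsum_nil.
rewrite copsum_cons [X in _ + X](_ : _ = 0) ?addr0; first by rewrite IH // => x y xw; apply: f0.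
apply: (copsum_in (P := fun x y => (size x <= size w)%N) (A := fun z => z = 0)).
- exact: subspace_eq0.
- by move=> s /size_cop <-; apply: leq_addr.
- by move=> x y xw; apply: f0; rewrite size_sigmaw.
Qed.

Section Socle.
Variables (n : nat) (G H : rel nat).
Hypothesis GK : forall i j, G i j -> Kn n i j.
Hypothesis HG : forall i j, H i j -> G i j.

Let HK i j : H i j -> Kn n i j. Proof. by move/HG/GK. Qed.
Let K := prodspan n H G.
Let sK : subspace K := linspan_subspace _.

Definition homG d (v : FA) : Prop := wspan (fun w => gword G w /\ size w = d) v.

(** By [prodspan_inter], [v] is also outside E_H^+ E_n, so a functional of degree [d] separates it;
    homogeneity leaves only the part of the coproduct with second factor 1. *)
Lemma contract_to_one d v : homG d v -> ~ K v -> exists2 Phi,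
  dual_family n H Phi & contract Phi v = e [::].
Proof.
move=> vd vK.
have vL : ~ prodspan n H (Kn n) v.
  move=> vL; apply: vK; apply: prodspan_inter => //.
  by apply: wspan_sub vd => w [].
have vh : hom n d v.
  by apply: wspan_sub vd => w [/(gword_sub GK) -> ->]; rewrite eqxx.
have [psi [psiD psiL psiv]] := separating_functional HK vh vL.
set c := lin _ v in psiv.
exists (fun x y => (c : rat)^-1 * psi x).
  by apply: (@dual_family_scale n H _ (fun x _ => psi x)); apply: dual_family_constant psiD psiL.
have E x : homG d x -> contract (fun x y => (c : rat)^-1 * psi x) x =
    lin (fun w => ((c : rat)^-1 * psi w) *: e [::]) x.
  apply: eq_lin_wspan => w [_ wd]; rewrite copsum_bottom // => x' y.
  by rewrite wd => xd; rewrite psiD ?mulr0 ?scale0r // neq_ltn xd.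
rewrite E //.
have -> : lin (fun w => ((c : rat)^-1 * psi w) *: e [::]) v = ((c : rat)^-1 * c) *: e [::].
  rewrite /c; have [P ->] := toFP v; rewrite !lin_toF mulr_sumr scaler_suml.
  by apply: eq_bigr => t _; rewrite scalerA mulrCA.
by rewrite mulVf // scale1r.
Qed.

Variables (d0 : nat) (w0 : word).
Hypothesis w0G : gword G w0.
Hypothesis w0d : size w0 = d0.
Hypothesis w0K : ~ K (e w0).
Hypothesis topK : forall w, gword G w -> size w = d0.+1 -> K (e w).

Lemma above_top w : gword G w -> (d0 < size w)%N -> K (e w).
Proof.
move=> wG wd; rewrite -[w](cat_take_drop d0.+1) -rmulE.
move: wG; rewrite -{1}[w](cat_take_drop d0.+1) gword_cat => /andP[tG dG].
apply: K_rmul => //; apply: topK => //.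
by rewrite size_takel.
Qed.

Lemma socle_contract v : wspan (gword G) v ->
  exists2 Phi, dual_family n H Phi & K (v - contract Phi (e w0)).
Proof.
apply: (wspan_min (B := fun v => exists2 Phi, _ & K (v - contract Phi (e w0)))).
  split=> [|u v' [Phi dP uP] [Psi dQ vQ]|c v' [Phi dP vP]].
  - exists (fun _ _ => 0); first exact: dual_family0.
    rewrite linE (copsum_ext _ (g := fun _ _ => 0)) ?copsum0 ?subr0; first exact: linspan0.
    by move=> x y; rewrite scale0r.
  - exists (fun x y => Phi x y + Psi x y); first exact: dual_family_add.
    rewrite linE (copsum_ext _ (g := fun x y => Phi x y *: e y + Psi x y *: e y)).
      rewrite copsum_add opprD addrACA; move: uP vQ; rewrite !linE; exact: linspanD.
    by move=> x y; rewrite scalerDl.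
  - exists (fun x y => c * Phi x y); first exact: dual_family_scale.
    rewrite linE (copsum_ext _ (g := fun x y => c *: (Phi x y *: e y))).
      rewrite copsum_scale -scalerBr; move: vP; rewrite !linE; exact: linspanZ.
    by move=> x y; rewrite scalerA.
elim/last_ind => [_|w a IH].
  have [Phi dP E] := contract_to_one (wspan_e (conj w0G w0d)) w0K.
  by exists Phi; rewrite // E subrr; apply: linspan0.
rewrite /gword all_rcons => /andP[aG /IH[Phi dP wP]].
(* Modulo [K], w a is T_Phi(w0) a, which is a contraction of w0 a minus the twisted contraction of
   w0. The former is in [K] since w0 a exceeds the top degree, hence the sign -1. *)
have aK := GK aG; pose Psi x y := Phi (rcons x (lact y a)) (rcons y a).
exists (fun x y => -1 * Psi x y); first by apply/dual_family_scale/dual_family_twist.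
have -> : contract (fun x y => -1 * Psi x y) (e w0) = - contract Psi (e w0).
  rewrite !linE (copsum_ext _ (g := fun x y => -1 *: (Psi x y *: e y))).
    by rewrite copsum_scale scaleN1r.
  by move=> x y; rewrite scalerA.
have wa : K (rmul [:: a] (e w - contract Phi (e w0))).
  by apply: K_rmul => //; rewrite /gword /= aG.
have w0a : K (contract (fun x y => Phi x (rcons y a)) (rmul [:: a] (e w0))).
  apply: contract_K => //; first exact: dual_family_rcons.
  by rewrite rmulE; apply: above_top; rewrite ?gword_cat ?w0G /= ?aG // size_cat w0d addn1.
rewrite (contract_rmul _ _ dP) in w0a; rewrite linearB /= rmulE cats1 in wa.
have := linspanD wa w0a; rewrite opprK; congr linspan.
by rewrite addrACA addNr addr0.
Qed.

(** Only the term 1 ⊗ w0 of the coproduct contributes in degree [d0] to a contraction of w0. *)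
Lemma socle_line v : homG d0 v -> exists c, K (v - c *: e w0).
Proof.
move=> vd; have vG : wspan (gword G) v by apply: wspan_sub vd => w [].
have [Phi _ vP] := socle_contract vG.
exists (Phi [::] w0); have := degpart_prodspan d0 HK GK vP.
rewrite linearB /= (degpart_same vd); congr (linspan _ (_ - _)).
rewrite linE copsum_lin copsum_top => [|x y]; rewrite linearZ /= linE.
  by rewrite w0d eqxx.
by rewrite w0d => /ltn_eqF ->; rewrite scaler0.
Qed.

Lemma reach_socle d v : homG d v -> ~ K v ->
  exists w, [/\ gword G w, (size w + d)%N = d0 & ~ K (rmul w v)].
Proof.
move=> vd vK; apply: NNPP => none.
have allK w : gword G w -> (size w + d)%N = d0 -> K (rmul w v).
  by move=> wG wd; apply: NNPP => nK; apply: none; exists w.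
have dlt : (d < d0)%N.
  case: (ltngtP d d0) => // [gt|eq]; case: vK.
    by apply: (wspan_min sK) vd => w [wG wd]; apply: above_top; rewrite // wd.
  by rewrite -[v]lin_id -(@lin_ext _ (fun w => e (w ++ [::]))) => [|w]; [apply: allK|rewrite cats0].
(* [N] collects [K] and the contractions of the products v w of degree below [d0]. It will be a
   right ideal containing 1, hence will contain all words of [G]. *)
pose N z := linspan (fun z => (exists Phi w, [/\ dual_family n H Phi, gword G w,
  (size w + d < d0)%N & z = contract Phi (rmul w v)]) \/ K z) z.
have N1 : N (e [::]).
  have [Phi dP E] := contract_to_one vd vK; apply: linspan_gen; left.
  exists Phi, [::]; split=> //; rewrite -E; congr (contract _ _).
  by rewrite -[LHS]lin_id; apply: lin_ext => w; rewrite cats0.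
have NK z : K z -> N z by move=> zK; apply: linspan_gen; right.
have Nmul a z : G a.1 a.2 -> N z -> N (rmul [:: a] z).
  move=> aG; apply: linspan_lin => [|y [[Phi [w [dP wG wd ->]]]|zK]]; first exact: linspan_subspace.
    have aK := GK aG; have -> : rmul [:: a] (contract Phi (rmul w v)) =
        contract (fun x y => Phi x (rcons y a)) (rmul [:: a] (rmul w v)) -
        contract (fun x y => Phi (rcons x (lact y a)) (rcons y a)) (rmul w v).
      by rewrite (contract_rmul _ _ dP) addrAC subrr add0r.
    have -> : rmul [:: a] (rmul w v) = rmul (rcons w a) v.
      have [P ->] := toFP v; rewrite !linear_sum; apply: eq_bigr => t _.
      by rewrite !linearZ /= !rmulE -catA cats1.
    have dPa := dual_family_rcons aK dP; have dPt := dual_family_twist aK dP.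
    have waG : gword G (rcons w a) by rewrite /gword all_rcons aG.
    apply: linspanB; last by apply: linspan_gen; left; do 2!eexists; split; [exact: dPt|exact: wG| |].
    (* Appending [a] may reach degree [d0] exactly; there [allK] puts v w a in [K]. *)
    move: (wd); rewrite leq_eqVlt => /orP[/eqP wd'|wd'].
      by apply: NK; apply: contract_K => //; apply: allK => //; rewrite size_rcons.
    apply: linspan_gen; left; do 2!eexists; split; [exact: dPa|exact: waG| |reflexivity].
    by rewrite size_rcons.
  by apply: NK; apply: K_rmul => //; rewrite /gword /= aG.
have Nw w : gword G w -> N (e w).
  elim/last_ind: w => [//|w a IH]; rewrite /gword all_rcons => /andP[aG /IH wN].
  by rewrite -cats1 -rmulE; apply: Nmul.
(* Contraction does not raise degrees, so modulo [K] nothing in [N] has a component in degree [d0];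
   this contradicts [w0K]. *)
have degN z : N z -> K (degpart d0 z).
  apply: linspan_lin => [|y [[Phi [w [dP wG wd ->]]]|zK]] //; last exact: degpart_prodspan.
  rewrite (_ : degpart d0 _ = 0); first exact: linspan0.
  have : wspan (fun x => (size x < d0)%N) (rmul w v).
    apply: wspan_lin vd => [|x [_ xd]]; first exact: linspan_subspace.
    by rewrite rmulE; apply: wspan_e; rewrite size_cat xd addnC.
  move=> h; apply: (degpart_other (P := fun x => (size x < d0)%N)) => [x xd|].
    by rewrite neq_ltn xd.
  apply: wspan_lin h => [|x xd]; first exact: linspan_subspace.
  rewrite linE; apply: (copsum_in (P := fun _ y => (size y < d0)%N)).
  - exact: linspan_subspace.
  - by move=> s /size_cop sx; apply: leq_ltn_trans xd; rewrite -sx leq_addl.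
  - by move=> x' y' yd; apply: linspanZ; apply: wspan_e.
apply: w0K; have := degN _ (Nw _ w0G).
by rewrite linE w0d eqxx.
Qed.
End Socle.

(** * From families of functionals to a single functional *)

Lemma tperm_conj a b p : tperm (tperm a b.1, tperm a b.2) (tperm a p) = tperm a (tperm b p).
Proof.
rewrite {1}/tperm /= !(inj_eq (@tperm_inj a)) [tperm b p]/tperm.
by case: eqP => // _; case: eqP.
Qed.

Lemma pact_sigmaw a x z : pact (sigmaw a x) (tperm a z) = tperm a (pact x z).
Proof. by elim: x => //= b x ->; rewrite -/(tperm _ _) tperm_conj. Qed.

(** The twist [sigmaw a] conjugates the permutation of the first factor by that of [a], which is
    what moving [a] past this factor requires. *)
Lemma cop_pact w s : s \in cop w -> pact (s.1.2 ++ s.2) =1 pact w.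
Proof.
elim: w s => [|a w IH] s; first by rewrite inE => /eqP ->.
rewrite mem_cat => /orP[] /mapP[t /IH tw ->] p /=; rewrite -tw //.
by rewrite !pact_cat /= pact_sigmaw.
Qed.

Lemma eq_pact_rev x x' : pact x =1 pact x' -> pact (rev x) =1 pact (rev x').
Proof.
move=> xx p; have := pact_rev (rev x) p; rewrite revK => {2}<-.
by rewrite xx pact_rev.
Qed.

(* On the words [x] of [Delta w0], the S_n-degree of the second tensor factor is
   [pact (rev x ++ w0)]: contracting [w0] against the family amounts to a single functional. *)
Lemma dual_family_specialize n (H : rel nat) Phi w0 :
  (forall i j, H i j -> Kn n i j) ->
  gword (Kn n) w0 -> dual_family n H Phi ->
  exists2 phi, dual_family n H (fun x _ => phi x) &
    contract (fun x _ => phi x) (e w0) = contract Phi (e w0).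
Proof.
move=> HK w0n [kill perm [D bound]]; exists (fun x => Phi x (rev x ++ w0)); last first.
  rewrite !linE; apply: eq_big_seq => s sw; congr (_ *: (_ *: _)); apply: perm => p.
  by rewrite pact_cat -(cop_pact sw) pact_cat pact_rev.
have revn x : gword (Kn n) x -> gword (Kn n) (rev x ++ w0).
  by move=> xn; rewrite gword_cat w0n andbT /gword all_rev.
split=> //; last by exists D => x _; apply: bound.
move=> _ v _; apply: (linspan_lin (B := fun z => z = 0)) => [|x]; first exact: subspace_eq0.
case=> [[a [w [aH wn ->]]]|[u [r [w [un wn rn ->]]]]].
  have aw : gword (Kn n) (a :: w) by rewrite /= HK.
  rewrite linE -[LHS](linE (Phi^~ (rev (a :: w) ++ w0) : word -> rat^o)).
  by apply: (kill _ _ (revn _ aw)); apply: linspan_gen; left; exists a, w.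
rewrite lin_insertion; case: r rn => [|t0 r] rn; first by rewrite /insertion big_nil.
have [d [_ /(_ t0 (mem_head _ _))[t0n _]]] := fk_rel_hom rn.
have y0n : gword (Kn n) (u ++ t0.2 ++ w) by rewrite !gword_cat un t0n.
(* All words of the relator have one S_n-degree, so the second argument can be frozen at the value
   given by [t0], where [kill] applies. *)
rewrite -[RHS](kill _ (insertion e u (t0 :: r) w) (revn _ y0n)); last first.
  by apply: linspan_gen; right; exists u, (t0 :: r), w.
rewrite lin_insertion; apply: eq_big_seq => t tr; congr (_ *: _); apply: perm => p.
rewrite !pact_cat; apply: eq_pact_rev => {}p.
by rewrite !pact_cat (fk_rel_pact rn tr (mem_head _ _)).
Qed.

(** * Concrete polynomials *)

Lemma toF_cat P Q : toF (P ++ Q) = toF P + toF Q.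
Proof. exact: big_cat. Qed.

Lemma toF_pscale c P : toF (pscale c P) = c *: toF P.
Proof. by rewrite /toF big_map scaler_sumr; apply: eq_bigr => t _; rewrite scalerA. Qed.

Lemma toF_popp P : toF (popp P) = - toF P.
Proof. by rewrite toF_pscale scaleN1r. Qed.

Lemma toF_flatten ss : toF (flatten ss) = \sum_(s <- ss) toF s.
Proof.
by elim: ss => [|s ss IH]; rewrite ?big_nil ?big_cons /= ?toF_cat ?IH // /toF big_nil.
Qed.

Lemma toF_pword w : toF (pword w) = e w.
Proof. by rewrite /toF big_seq1 scale1r. Qed.

Lemma toF_coef P Q : (forall w, coef P w = coef Q w) <-> toF P = toF Q.
Proof.
split=> [PQ|PQ w]; last by rewrite -!coefF_toF PQ.
apply/eqP; rewrite -subr_eq0; apply/eqP/coefF_eq0 => x.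
by rewrite raddfB /= !coefF_toF PQ subrr.
Qed.

Lemma wspan_toF (A : word -> Prop) v : wspan A v ->
  exists Q : fpoly, (forall t, t \in Q -> A t.2) /\ toF Q = v.
Proof.
apply: (wspan_min (B := fun v => exists Q : fpoly, _ /\ toF Q = v)) => [|w Aw].
  split=> [|_ _ [Q [QA <-]] [R [RA <-]]|c _ [Q [QA <-]]].
  - by exists [::]; split=> //; rewrite /toF big_nil.
  - exists (Q ++ R); split; last exact: toF_cat.
    by move=> t; rewrite mem_cat => /orP[/QA|/RA].
  - exists (pscale c Q); split; last exact: toF_pscale.
    by move=> _ /mapP[t /QA tA ->].
exists (pword w); split; last exact: toF_pword.
by move=> t; rewrite inE => /eqP ->.
Qed.

Lemma toF_wspan (A : word -> Prop) (Q : fpoly) :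
  (forall t, t \in Q -> A t.2) -> wspan A (toF Q).
Proof.
move=> QA; apply: subspace_sum => [|t /QA tA]; first exact: linspan_subspace.
exact/linspanZ/wspan_e.
Qed.

Definition mulF (x y : FA) : FA := lin (fun u => lmul u y) x.

Lemma mulF_el u y : mulF (e u) y = lmul u y.
Proof. exact: linE. Qed.

Lemma mulF_er x u : mulF x (e u) = rmul u x.
Proof. by apply: lin_ext => w; rewrite lmulE. Qed.

Lemma mulF_toF P y : mulF (toF P) y = \sum_(t <- P) t.1 *: lmul t.2 y.
Proof. exact: lin_toF. Qed.

Lemma mulF_linear x : linear (mulF x).
Proof.
move=> c y z; have [P ->] := toFP x; rewrite !mulF_toF scaler_sumr -big_split.
by apply: eq_bigr => t _ /=; rewrite linearP scalerDr !scalerA mulrC.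
Qed.
HB.instance Definition _ x := GRing.isLinear.Build rat FA FA _ (mulF x) (mulF_linear x).

(** Exchanging the arguments allows linearity in the left factor to be registered too. *)
Definition mulFr (y x : FA) : FA := mulF x y.
HB.instance Definition _ y := GRing.Linear.copy (mulFr y) (lin (fun u => lmul u y)).

Lemma mulFZl c x y : mulF (c *: x) y = c *: mulF x y.
Proof. by rewrite /mulF linearZ. Qed.

Lemma mulF_lmul u x y : mulF (lmul u x) y = lmul u (mulF x y).
Proof.
have [P ->] := toFP x; rewrite mulF_toF /mulF !linear_sum; apply: eq_bigr => t _.
by rewrite !linearZ /= lmulE linE lmul_cat.
Qed.

Lemma toF_pmul P Q : toF (pmul P Q) = mulF (toF P) (toF Q).
Proof.
rewrite mulF_toF /toF /pmul big_allpairs_dep; apply: eq_bigr => t _.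
rewrite linear_sum scaler_sumr; apply: eq_bigr => s _ /=.
by rewrite linearZ /= lmulE scalerA.
Qed.

Lemma toF_relator u r v : toF (pmul (pword u) (pmul r (pword v))) = insertion e u r v.
Proof.
rewrite !toF_pmul !toF_pword mulF_el mulF_er /toF !linear_sum.
by apply: eq_bigr => t _; rewrite !linearZ /= rmulE lmulE.
Qed.

Lemma ideal_inI n x : ideal n x -> exists2 P, inI n P & toF P = x.
Proof.
apply: (linspan_min (B := fun x => exists2 P, inI n P & toF P = x)).
  split=> [|_ _ [P IP <-] [Q IQ <-]|c _ [P IP <-]].
  - by exists [::]; [exact: inI_nil|rewrite /toF big_nil].
  - by exists (P ++ Q); [exact: inI_add|exact: toF_cat].
  - by exists (pscale c P); [exact: inI_scale|exact: toF_pscale].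
move=> _ [u [r [v [un vn rn ->]]]]; exists (pmul (pword u) (pmul r (pword v))).
  exact: inI_rel.
exact: toF_relator.
Qed.

Lemma inI_ideal n P : inI n P <-> ideal n (toF P).
Proof.
split=> [|/ideal_inI[Q IQ QP]]; last by apply: inI_ext IQ; apply/toF_coef.
elim=> {P} [|u r v un vn rn|P Q _ IP _ IQ|c P _ IP|P Q PQ _ IP].
- by rewrite /toF big_nil; apply: linspan0.
- by rewrite toF_relator; apply: linspan_gen; exists u, r, v.
- by rewrite toF_cat; apply: linspanD.
- by rewrite toF_pscale; apply: linspanZ.
- by rewrite -(proj1 (toF_coef P Q) PQ).
Qed.

Lemma eqFK_ideal n P Q : eqFK n P Q <-> ideal n (toF P - toF Q).
Proof. by rewrite /eqFK inI_ideal toF_cat toF_popp. Qed.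

Section Translation.
Variable n : nat.

Let sI : subspace (ideal n) := linspan_subspace _.

Lemma inEG_wspan G P : inEG n G P <-> exists2 x, wspan (gword G) x & ideal n (toF P - x).
Proof.
split=> [[Q [QG /eqFK_ideal PQ]]|[x /wspan_toF[Q [QG <-]] PQ]].
  by exists (toF Q) => //; apply: toF_wspan.
by exists Q; split=> //; apply/eqFK_ideal.
Qed.

Lemma inEGp_wspan G P : inEGp n G P <->
  exists2 x, wspan (fun w => gword G w && (0 < size w)%N) x & ideal n (toF P - x).
Proof.
split=> [[Q [QG /eqFK_ideal PQ]]|[x /wspan_toF[Q [QG <-]] PQ]].
  by exists (toF Q) => //; apply: toF_wspan QG.
by exists Q; split=> //; apply/eqFK_ideal.
Qed.

Lemma homog_wspan d P : homog n d P <->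
  exists2 x, wspan (fun w => size w = d) x & ideal n (toF P - x).
Proof.
split=> [[Q [QG /eqFK_ideal PQ]]|[x /wspan_toF[Q [QG <-]] PQ]].
  by exists (toF Q) => //; apply: toF_wspan QG.
by exists Q; split=> //; apply/eqFK_ideal.
Qed.

Lemma ideal_rmul u v : gword (Kn n) u -> ideal n v -> ideal n (rmul u v).
Proof.
move=> un; apply: lin_ideal => // u' r v' un' vn' rn; apply: linspan_gen.
exists u', r, (v' ++ u); split=> //; rewrite ?gword_cat ?vn' //.
by apply: eq_bigr => t _; rewrite -!catA.
Qed.

Lemma ideal_wspan v : ideal n v -> wspan (gword (Kn n)) v.
Proof.
apply: linspan_min => [|x /relator_hom[d [_ xd]]]; first exact: linspan_subspace.
by apply: wspan_sub xd => w /andP[].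
Qed.

Lemma ideal_mulFl x y : wspan (gword (Kn n)) y -> ideal n x -> ideal n (mulF x y).
Proof.
move=> yn xI; apply: (wspan_min (B := fun y => ideal n (mulF x y))) yn.
  exact: (subspace_preim (mulF x)).
by move=> w wn; rewrite mulF_er; apply: ideal_rmul.
Qed.

Lemma ideal_mulFr x y : wspan (gword (Kn n)) x -> ideal n y -> ideal n (mulF x y).
Proof.
move=> xn yI; apply: (wspan_min (B := fun x => ideal n (mulFr y x))) xn.
  exact: (subspace_preim (mulFr y)).
by move=> w wn; rewrite /mulFr mulF_el; apply: ideal_lmul.
Qed.

(** Relators are flanked by words of [Kn n] only, whence the conditions on [x'] and [y']; they pass
    to [y] because the ideal is spanned by such words. *)
Lemma ideal_mulF x x' y y' : wspan (gword (Kn n)) x' -> wspan (gword (Kn n)) y' ->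
  ideal n (x - x') -> ideal n (y - y') -> ideal n (mulF x y - mulF x' y').
Proof.
move=> xn yn xI yI; have yn' : wspan (gword (Kn n)) y.
  by rewrite -(subrK y' y); apply: linspanD => //; apply: ideal_wspan.
have -> : mulF x y - mulF x' y' = mulF (x - x') y + mulF x' (y - y').
  rewrite -/(mulFr y (x - x')) (linearB (mulFr y)) (linearB (mulF x')) /mulFr.
  by rewrite addrA subrK.
by apply: linspanD; [apply: ideal_mulFl|apply: ideal_mulFr].
Qed.

Lemma ideal_trans x y z : ideal n (x - y) -> ideal n (y - z) -> ideal n (x - z).
Proof. by move=> xy yz; rewrite -(subrKA y x (- z)); apply: linspanD. Qed.

(** Relators have positive degree, so constant terms are well defined on E_n. *)
Lemma ideal_nil x : ideal n x -> coefF [::] x = 0.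
Proof.
apply: (linspan_lin (B := fun z => z = 0)) => [|y]; first exact: subspace_eq0.
move=> /relator_hom[d [d0 yd]]; apply: wspan_kernel yd => w /andP[_ /eqP wd].
by case: w wd => // d00; rewrite -d00 in d0.
Qed.

Lemma degpart_ideal d x : ideal n x -> ideal n (degpart d x).
Proof.
apply: linspan_lin => // y yr; have [d' [_ yd]] := relator_hom yr.
have [dd|dd] := eqVneq d' d.
  rewrite (degpart_same (P := gword (Kn n))); first exact: linspan_gen.
  by apply: wspan_sub yd => w; rewrite dd => /andP[? /eqP].
rewrite (degpart_other _ yd); first exact: linspan0.
by move=> w /andP[_ /eqP ->].
Qed.

Variables (G H : rel nat).
Hypothesis GK : forall i j, G i j -> Kn n i j.
Hypothesis HG : forall i j, H i j -> G i j.
Let HK i j : H i j -> Kn n i j. Proof. by move/HG/GK. Qed.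
Let K := prodspan n H G.
Let sK : subspace K := linspan_subspace _.

(** Applied with [G] for congruences modulo E_H^+ E_G, and with [Kn n] for the vanishing condition
    in (b). *)
Lemma inProd_prodspan P : inProd n H G P <-> prodspan n H G (toF P).
Proof.
split=> [[s [sG /eqFK_ideal Ps]]|].
  rewrite -[toF P](subrK (toF (flatten [seq pmul ab.1 ab.2 | ab <- s]))).
  apply: linspanD; first exact: ideal_prodspan.
  rewrite toF_flatten big_map; apply: subspace_sum => // ab /sG[].
  move=> /inEGp_wspan[x xH abx] /inEG_wspan[y yG aby].
  rewrite toF_pmul -[mulF _ _](subrK (mulF x y)); apply: linspanD.
    apply: ideal_prodspan; apply: ideal_mulF => //.
      by apply: wspan_sub xH => w /andP[wH _]; apply: gword_sub wH.
    by apply: wspan_sub yG => w; apply: gword_sub.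
  apply: (wspan_lin (f := mulFr y) _ _ xH) => // -[|a u] // /andP[/= /andP[aH uH] _].
  rewrite /mulFr mulF_el; apply: wspan_lin yG => // w wG; rewrite lmulE.
  apply: linspan_gen; left; exists a, (u ++ w); split=> //.
  by rewrite gword_cat wG andbT; apply: gword_sub uH.
suff main x : K x -> exists2 s : seq (fpoly * fpoly),
    forall ab, ab \in s -> inEGp n H ab.1 /\ inEG n G ab.2 &
    ideal n (x - \sum_(ab <- s) toF (pmul ab.1 ab.2)).
  move=> /main[s sG sI']; exists s; split=> //; apply/eqFK_ideal.
  by rewrite toF_flatten big_map.
apply: (linspan_min (B := fun x => exists2 s : seq (fpoly * fpoly), _ &
  ideal n (x - \sum_(ab <- s) toF (pmul ab.1 ab.2)))) => [|y].
  split=> [|y z [s sG ys] [t tG zt]|c y [s sG ys]].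
  - by exists [::] => //; rewrite big_nil subrr; apply: linspan0.
  - exists (s ++ t); first by move=> ab; rewrite mem_cat => /orP[/sG|/tG].
    by rewrite big_cat opprD addrACA; apply: linspanD.
  - exists [seq (pscale c ab.1, ab.2) | ab <- s].
      move=> _ /mapP[ab /sG[/inEGp_wspan[z xH abz] ab2] ->]; split=> //=.
      apply/inEGp_wspan; exists (c *: z); first exact: linspanZ.
      by rewrite toF_pscale -scalerBr; apply: linspanZ.
    rewrite big_map /= (eq_bigr (fun ab => c *: toF (pmul ab.1 ab.2))) => [|ab _].
      by rewrite -scaler_sumr -scalerBr; apply: linspanZ.
    by rewrite !toF_pmul toF_pscale mulFZl.
case=> [[a [w [aH wG ->]]]|yr]; last first.
  by exists [::] => //; rewrite big_nil subr0; apply: linspan_gen.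
exists [:: (pword [:: a], pword w)].
  move=> ab; rewrite inE => /eqP -> /=; split.
    apply/inEGp_wspan; exists (e [:: a]); first by apply: wspan_e; rewrite /= aH.
    by rewrite toF_pword subrr; apply: linspan0.
  apply/inEG_wspan; exists (e w); first exact: wspan_e.
  by rewrite toF_pword subrr; apply: linspan0.
by rewrite big_seq1 toF_pmul !toF_pword mulF_el lmulE subrr; apply: linspan0.
Qed.
End Translation.

Lemma finite_choice (T : Type) (y0 : T) N (R : nat -> T -> Prop) :
  (forall i, (i < N)%N -> exists y, R i y) -> exists f : nat -> T, forall i, (i < N)%N -> R i (f i).
Proof.
elim: N => [|N IH] RN; first by exists (fun=> y0).
have [|f fR] := IH; first by move=> i iN; apply: RN; apply: leqW.
have [y yR] := RN N (leqnn _); exists (fun i => if i == N then y else f i) => i.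
by rewrite ltnS leq_eqVlt; case: eqP => [->|_ /fR].
Qed.

Lemma toF_lincomb (a M : seq fpoly) : size a = size M ->
  toF (lincomb a M) = \sum_(i < size M) mulF (toF (nth [::] a i)) (toF (nth [::] M i)).
Proof.
move=> aM; rewrite /lincomb toF_flatten big_map (big_nth ([::], [::])) size_zip aM minnn.
rewrite big_mkord; apply: eq_bigr => i _; rewrite nth_zip //=; exact: toF_pmul.
Qed.

(** * The basis [M] modulo E_H^+ E_G *)

Section Basis.
Variables (n : nat) (G H : rel nat) (M : seq fpoly).
Hypothesis GK : forall i j, G i j -> Kn n i j.
Hypothesis HG : forall i j, H i j -> G i j.
Hypothesis basisM : is_basis n H G M.
Let HK i j : H i j -> Kn n i j. Proof. by move/HG/GK. Qed.
Let K := prodspan n H G.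
Let sK : subspace K := linspan_subspace _.
Let sI : subspace (ideal n) := linspan_subspace _.
Let N := size M.
Let mu i : FA := toF (nth [::] M i).

(** Membership in E_G and homogeneity provide two unrelated representatives; the degree [d] part of
    the first has both properties, as the ideal is graded. *)
Lemma basis_representative i d : (i < N)%N -> homog n d (nth [::] M i) ->
  exists2 x, homG G d x & ideal n (mu i - x).
Proof.
move=> iN /homog_wspan[y yd my]; have [MG _ _] := basisM.
have /inEG_wspan[x xG mx] := MG _ (mem_nth [::] iN).
exists (degpart d x).
  apply: wspan_lin xG => [|w wG]; first exact: linspan_subspace.
  by rewrite linE; case: eqP => wd; [apply: wspan_e|apply: linspan0].
apply: (ideal_trans my); rewrite -[y in y - _](degpart_same (P := fun=> True) (d := d)).
  rewrite -linearB; apply: degpart_ideal.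
  by apply: (ideal_trans _ mx); rewrite -opprB; apply: linspanN.
exact: wspan_sub yd.
Qed.

Lemma basis_wspan i : (i < N)%N -> exists2 x, wspan (gword G) x & ideal n (mu i - x).
Proof. by move=> iN; have [MG _ _] := basisM; apply/inEG_wspan/MG/mem_nth. Qed.

Lemma lmul_basis i u : (i < N)%N -> gword H u -> (0 < size u)%N -> K (lmul u (mu i)).
Proof.
move=> /basis_wspan[x xG mx] uH u0; rewrite -[mu i](subrK x) linearD; apply: linspanD.
  by apply: ideal_prodspan; apply: ideal_lmul => //; apply: gword_sub uH.
case: u uH u0 => // a u /andP[aH uH] _; apply: wspan_lin xG => // w wG; rewrite lmulE.
apply: linspan_gen; left; exists a, (u ++ w); split=> //.
by rewrite gword_cat wG andbT; apply: gword_sub uH.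
Qed.

(** Nonempty words of [H] act by zero modulo [K], so only the constant term of the coefficient
    counts. *)
Lemma basis_scalar i P : (i < N)%N -> inEG n H P ->
  exists c, K (mulF (toF P) (mu i) - c *: mu i).
Proof.
move=> iN /inEG_wspan[x xH Px]; have [y yG my] := basis_wspan iN.
have muK : wspan (gword (Kn n)) (mu i).
  rewrite -[mu i](subrK y); apply: linspanD; first exact: ideal_wspan.
  by apply: wspan_sub yG => w; apply: gword_sub.
suff [c cK] : exists c, K (mulF x (mu i) - c *: mu i).
  exists c; rewrite -(subrK (mulF x (mu i)) (mulF (toF P) (mu i))) -addrA.
  apply: linspanD => //; apply: ideal_prodspan; apply: ideal_mulF => //.
    by apply: wspan_sub xH => w; apply: gword_sub.
  by rewrite subrr; apply: linspan0.
apply: (wspan_min (B := fun x => exists c, K (mulF x (mu i) - c *: mu i))) xH.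
  split=> [|u v [c uc] [d vd]|c u [d ud]].
  - by exists 0; rewrite /mulF linear0 scale0r subrr; apply: linspan0.
  - exists (c + d); rewrite /mulF linearD -/(mulF u _) -/(mulF v _) scalerDl opprD addrACA.
    exact: linspanD.
  - by exists (c * d); rewrite mulFZl -scalerA -scalerBr; apply: linspanZ.
case=> [_|a u uH]; first by exists 1; rewrite mulF_el /lmul lin_id scale1r subrr; apply: linspan0.
by exists 0; rewrite scale0r subr0 mulF_el; apply: lmul_basis.
Qed.

Lemma basis_span x : wspan (gword G) x ->
  exists c : nat -> rat, K (x - \sum_(i < N) c i *: mu i).
Proof.
move=> xG; have [Q [QG Qx]] := wspan_toF xG; have [_ spanM _] := basisM.
have [|a [aM aH]] := spanM Q.
  by apply/inEG_wspan; exists x; rewrite // Qx subrr; apply: linspan0.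
move=> /eqFK_ideal; rewrite toF_lincomb // Qx => xa.
have [|c cK] := @finite_choice _ (0 : rat) N (fun i c =>
    K (mulF (toF (nth [::] a i)) (mu i) - c *: mu i)).
  by move=> i iN; apply: basis_scalar => //; apply: aH; rewrite mem_nth // aM.
exists c; rewrite -(subrK (\sum_(i < N) mulF (toF (nth [::] a i)) (mu i)) x) -addrA.
apply: linspanD; first exact: ideal_prodspan.
by rewrite -sumrB; apply: subspace_sum => // i _; apply: cK.
Qed.

(** For a generator b w, expand w in the basis and multiply the coefficients by b, which brings them
    into E_H^+. *)
Lemma prodspan_lincomb x : K x -> exists2 a : nat -> fpoly,
  forall i, inEGp n H (a i) & ideal n (x - \sum_(i < N) mulF (toF (a i)) (mu i)).
Proof.
apply: (linspan_min (B := fun x => exists2 a : nat -> fpoly, forall i, inEGp n H (a i) &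
  ideal n (x - \sum_(i < N) mulF (toF (a i)) (mu i)))) => [|y].
  split=> [|y z [a aH ya] [b bH zb]|c y [a aH ya]].
  - exists (fun=> [::]) => [i|].
      by apply/inEGp_wspan; exists 0; rewrite /toF ?big_nil ?subrr; apply: linspan0.
    rewrite big1 ?subrr => [|i _]; first exact: linspan0.
    by rewrite /mulF /toF big_nil linear0.
  - exists (fun i => a i ++ b i) => [i|].
      have /inEGp_wspan[u uH ua] := aH i; have /inEGp_wspan[v vH vb] := bH i.
      apply/inEGp_wspan; exists (u + v); first exact: linspanD.
      by rewrite toF_cat opprD addrACA; apply: linspanD.
    rewrite (eq_bigr (fun i : 'I_N => mulF (toF (a i)) (mu i) + mulF (toF (b i)) (mu i))) => [|i _].
      by rewrite big_split opprD addrACA; apply: linspanD.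
    by rewrite toF_cat /mulF linearD.
  - exists (fun i => pscale c (a i)) => [i|].
      have /inEGp_wspan[u uH ua] := aH i.
      apply/inEGp_wspan; exists (c *: u); first exact: linspanZ.
      by rewrite toF_pscale -scalerBr; apply: linspanZ.
    rewrite (eq_bigr (fun i : 'I_N => c *: mulF (toF (a i)) (mu i))) => [|i _].
      by rewrite -scaler_sumr -scalerBr; apply: linspanZ.
    by rewrite toF_pscale mulFZl.
case=> [[b [w [bH wG ->]]]|yr]; last first.
  exists (fun=> [::]) => [i|].
    by apply/inEGp_wspan; exists 0; rewrite /toF ?big_nil ?subrr; apply: linspan0.
  rewrite big1 ?subr0 => [|i _]; first exact: linspan_gen.
  by rewrite /mulF /toF big_nil linear0.
have [_ spanM _] := basisM; have [|a [aM aH]] := spanM (pword w).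
  apply/inEG_wspan; exists (e w); first exact: wspan_e.
  by rewrite toF_pword subrr; apply: linspan0.
move=> /eqFK_ideal; rewrite toF_lincomb // toF_pword => wa.
have b1 : gword (Kn n) [:: b] by rewrite /gword /= HK.
exists (fun i => pmul (pword [:: b]) (nth [::] a i)) => [i|].
  have [ia|ia] := ltnP i (size a); last first.
    rewrite nth_default //; apply/inEGp_wspan; exists 0; first exact: linspan0.
    by rewrite /toF big_nil subrr; apply: linspan0.
  have /inEG_wspan[x' xH ax] := aH _ (mem_nth [::] ia).
  apply/inEGp_wspan; exists (lmul [:: b] x').
    apply: wspan_lin xH => [|u uH]; first exact: linspan_subspace.
    by rewrite lmulE; apply: wspan_e; rewrite /gword /= bH andbT.
  by rewrite toF_pmul toF_pword mulF_el -linearB; apply: ideal_lmul.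
rewrite -[b :: w]/([:: b] ++ w) -lmulE (eq_bigr (fun i : 'I_N =>
    lmul [:: b] (mulF (toF (nth [::] a i)) (mu i)))) => [|i _].
  by rewrite -linear_sum -linearB; apply: ideal_lmul.
by rewrite toF_pmul toF_pword mulF_el mulF_lmul.
Qed.

(** By [prodspan_lincomb] the sum also has coefficients [a i] in E_H^+. Freeness gives c i = a i in
    E_n, and comparing constant terms gives c i = 0. *)
Lemma basis_independent (c : nat -> rat) :
  K (\sum_(i < N) c i *: mu i) -> forall i, (i < N)%N -> c i = 0.
Proof.
move=> /prodspan_lincomb[a aH ca] i iN; have [_ _ freeM] := basisM.
have aE j : toF ((c j, [::]) :: popp (a j)) = c j *: e [::] - toF (a j).
  by rewrite -toF_popp /toF big_cons.
have : eqFK n ((c i, [::]) :: popp (a i)) [::].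
  apply: (freeM (mkseq (fun i => (c i, [::]) :: popp (a i)) N)).
  - exact: size_mkseq.
  - move=> _ /mapP[j _ ->]; have /inEGp_wspan[x xH ax] := aH j.
    apply/inEG_wspan; exists (c j *: e [::] - x).
      apply: linspanB; first exact/linspanZ/wspan_e.
      by apply: wspan_sub xH => w /andP[].
    by rewrite aE opprB addrC addrA subrK -opprB; apply: linspanN.
  - apply/eqFK_ideal; rewrite toF_lincomb ?size_mkseq // [toF [::]]/toF big_nil subr0.
    rewrite (eq_bigr (fun i : 'I_N => c i *: mu i - mulF (toF (a i)) (mu i))) => [|j _].
      by rewrite sumrB.
    rewrite nth_mkseq // aE /mulF linearB linearZ /= linE /lmul; congr (_ *: _ - _).
    exact: lin_id.
  - by apply/mapP; exists i; rewrite ?mem_iota.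
have /inEGp_wspan[x xH ax] := aH i.
move=> /eqFK_ideal; rewrite [toF [::]]/toF big_nil subr0 aE => /ideal_nil; rewrite raddfB /=.
have -> : coefF [::] (toF (a i)) = 0.
  rewrite -[toF (a i)](subrK x) raddfD /= (ideal_nil ax) add0r.
  by apply: wspan_kernel xH => -[|b w] //; rewrite andbF.
by rewrite subr0 /coefF linearZ /= linE eqxx /GRing.scale /= mulr1.
Qed.
End Basis.

Lemma ev_lin (q : word -> rat) P : ev q P = lin (q : word -> rat^o) (toF P).
Proof. by rewrite lin_toF. Qed.

Lemma toF_star (q : word -> rat) P : toF (star q P) = contract (fun x _ => q x) (toF P).
Proof.
rewrite /contract lin_toF toF_flatten big_map; apply: eq_bigr => t _.
rewrite /toF big_map /copsum scaler_sumr; apply: eq_bigr => s _ /=.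
by rewrite !scalerA.
Qed.

Section BasisSocle.
Variables (n : nat) (G H : rel nat) (M : seq fpoly).
Hypothesis GK : forall i j, G i j -> Kn n i j.
Hypothesis HG : forall i j, H i j -> G i j.
Hypothesis basisM : is_basis n H G M.
Hypothesis homM : forall m, m \in M -> exists d, homog n d m.
Let HK i j : H i j -> Kn n i j. Proof. by move/HG/GK. Qed.
Let K := prodspan n H G.
Let sK : subspace K := linspan_subspace _.
Let N := size M.
Let mu i : FA := toF (nth [::] M i).

(** Supplies the data of the top-degree arguments, with [d0] the largest degree in [M]. Some word
    [w0] of a top basis element is outside [K]; a word of degree [d0.+1] expands modulo [K] in
    elements of smaller degree, so it lies in [K]. *)
Lemma basis_socle : exists i0 d0 (d : nat -> nat) (x : nat -> FA) w0,
  [/\ [/\ (i0 < N)%N, d i0 = d0 & forall i, (i < N)%N -> (d i <= d0)%N],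
      forall i, (i < N)%N -> [/\ homog n (d i) (nth [::] M i), homG G (d i) (x i),
        ideal n (mu i - x i) & ~ K (x i)],
      [/\ gword G w0, size w0 = d0 & ~ K (e w0)] &
      forall w, gword G w -> size w = d0.+1 -> K (e w)].
Proof.
have [f fP] : exists f : nat -> nat * FA, forall i, (i < N)%N ->
    [/\ homog n (f i).1 (nth [::] M i), homG G (f i).1 (f i).2 & ideal n (mu i - (f i).2)].
  apply: (@finite_choice _ (0%N, 0 : FA) N (fun i y =>
    [/\ homog n y.1 (nth [::] M i), homG G y.1 y.2 & ideal n (mu i - y.2)])) => i iN;
  have [d md] := homM (mem_nth [::] iN).
  by have [x xd mx] := basis_representative basisM iN md; exists (d, x).
have fK i : (i < N)%N -> ~ K (f i).2.
  move=> iN fiK; have [_ _ mfi] := fP i iN.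
  have /(basis_independent GK HG basisM (c := fun j => (j == i)%:R)) :
      K (\sum_(j < size M) (j == i :> nat)%:R *: mu j).
    rewrite (bigD1 (Ordinal iN)) //= eqxx scale1r big1 ?addr0 => [|j ji].
      by rewrite -[mu i](subrK (f i).2); apply: linspanD => //; apply: ideal_prodspan.
    by rewrite -val_eqE /= in ji; rewrite (negbTE ji) scale0r.
  by move=> /(_ i iN) /eqP; rewrite eqxx oner_eq0.
have spanM := basis_span GK HG basisM.
(* Otherwise 1 would lie in [K], whose elements have no constant term. *)
have N_gt0 : (0 < N)%N.
  rewrite lt0n; apply/negP => /eqP N0.
  have [|c] := spanM (e [::]); first exact: wspan_e.
  rewrite big1 => [|[i iN]]; last by move: (iN); rewrite -/N N0.
  rewrite subr0 => eK; suff : coefF [::] (e [::]) = 0.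
    by rewrite linE eqxx => /eqP; rewrite oner_eq0.
  move: eK; apply: (linspan_lin (B := fun z => z = 0)) => [|y]; first exact: subspace_eq0.
  case=> [[a [w [_ _ ->]]]|yr]; first by rewrite linE.
  by apply: (ideal_nil (n := n)); apply: linspan_gen.
have [i0 i0N imax] : exists2 i0, (i0 < N)%N & forall i, (i < N)%N -> ((f i).1 <= (f i0).1)%N.
  case: (@arg_maxnP _ (Ordinal N_gt0) predT (fun i => (f i).1)) => // i _ imax.
  by exists i => // j jN; apply: (imax (Ordinal jN)).
have [w0 [w0G w0d w0K]] : exists w0, [/\ gword G w0, size w0 = (f i0).1 & ~ K (e w0)].
  apply: NNPP => none; apply: (fK i0) => //; have [_ x0 _] := fP i0 i0N.
  apply: wspan_min x0 => // w [wG wd]; apply: NNPP => wK; apply: none.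
  by exists w.
exists i0, (f i0).1, (fun i => (f i).1), (fun i => (f i).2), w0; split=> //.
  by move=> i iN; have [? ? ?] := fP i iN; split=> //; apply: fK.
move=> w wG wd; have [c wc] := spanM _ (wspan_e wG).
have : K (e w - \sum_(i < N) c i *: (f i).2).
  have -> : e w - \sum_(i < N) c i *: (f i).2 =
      (e w - \sum_(i < N) c i *: mu i) + \sum_(i < N) c i *: (mu i - (f i).2).
    rewrite [X in _ = _ + X](eq_bigr (fun i : 'I_N => c i *: mu i - c i *: (f i).2)) => [|i _].
      by rewrite sumrB subrKA.
    by rewrite scalerBr.
  apply: linspanD => //; apply: subspace_sum => // i _; apply: linspanZ.
  by apply: ideal_prodspan; have [_ _] := fP i (ltn_ord i).
move=> /(degpart_prodspan (f i0).1.+1 HK GK); rewrite linearB /= linE wd eqxx.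
rewrite linear_sum big1 ?subr0 // => i _; have [_ xi _] := fP i (ltn_ord i).
rewrite linearZ /= (degpart_other _ xi) ?scaler0 // => w' [_ ->].
by rewrite neq_ltn ltnS imax.
Qed.

End BasisSocle.

Theorem mainTheorem6 (n : nat) (G H : rel nat) (M : seq fpoly) :
  (0 < n)%N -> is_graph n G -> is_graph n H -> (forall i j, H i j -> G i j) ->
  fin_gen n H G -> is_basis n H G M -> (forall m, m \in M -> exists d, homog n d m) ->
  exists m0, m0 \in M /\
    (* (a) m0 is the unique element of M of maximum degree *)
    (exists d0, homog n d0 m0 /\
       forall m, m \in M -> eqFK n m m0 \/ (forall d, homog n d m -> (d < d0)%N)) /\
    (* (b) *)
    (forall m, m \in M -> exists q : word -> rat, is_dual n q /\
       (forall P, inProd n H (Kn n) P -> ev q P = 0) /\ eqmod n H G m (star q m0)) /\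
    (* (c) *)
    (forall m, m \in M -> exists g, inEG n G g /\ eqmod n H G m0 (pmul m g)).
Proof.
move=> _ [Gn _] _ HG _ basisM homM.
have GK i j : G i j -> Kn n i j by move=> /Gn[iN jN ij]; apply/and3P.
have HK i j : H i j -> Kn n i j by move/HG/GK.
have [i0 [d0 [d [x [w0 [[i0N di0 dmax] xP [w0G w0d w0K] topK]]]]]] :=
  basis_socle GK HG basisM homM.
pose mu i := toF (nth [::] M i); pose K := prodspan n H G.
have muP i : (i < size M)%N -> K (mu i - x i).
  by move=> /xP[_ _ mx _]; apply: ideal_prodspan.
have line i : (i < size M)%N -> d i = d0 -> exists2 c : rat, c != 0 & K (x i - c *: e w0).
  move=> iN di; have [_ xd _ xK] := xP i iN; rewrite di in xd.
  have [c xc] := socle_line GK HG w0G w0d w0K topK xd.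
  exists c => //; apply/eqP => c0; apply: xK.
  by move: xc; rewrite c0 scale0r subr0.
have [c0 c0_neq0 xc0] := line i0 i0N di0.
have mc0 : K (mu i0 - c0 *: e w0) by rewrite -(subrKA (x i0)); apply: linspanD => //; apply: muP.
exists (nth [::] M i0); split; first exact: mem_nth.
(* A basis element homogeneous of two degrees would vanish in E_n, hence lie in [K]. *)
have homx i d' : (i < size M)%N -> homog n d' (nth [::] M i) -> d' = d i.
  move=> iN /homog_wspan[y yd my]; have [_ xd mx xK] := xP i iN.
  apply/eqP/negPn/negP => dd; apply: xK; apply: ideal_prodspan.
  have := degpart_ideal (d i) (linspanB mx my).
  rewrite opprB addrC addrA subrK linearB /= (degpart_same xd) (degpart_other _ yd).
    by rewrite sub0r => /linspanN; rewrite opprK.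
  by move=> w ->.
split; last split.
- exists d0; rewrite -{1}di0; split; first by have [] := xP i0 i0N.
  move=> m /(nthP [::])[i iN <-]; have [->|ii] := eqVneq i i0.
    by left; apply/eqFK_ideal; rewrite subrr; apply: linspan0.
  right=> d' /(homx _ _ iN) ->; rewrite ltn_neqAle dmax // andbT.
  apply/eqP => di; have [c c_neq0 xc] := line i iN di.
  have mc : K (mu i - c *: e w0) by rewrite -(subrKA (x i)); apply: linspanD => //; apply: muP.
  (* Both elements are multiples of [w0] modulo [K], by [c] and [c0]; these coefficients cancel [w0]
     and contradict independence. *)
  pose b j := if j == i then c0 else if j == i0 then - c else 0.
  have : K (\sum_(j < size M) b j *: mu j).
    rewrite (bigD1 (Ordinal iN)) //= (bigD1 (Ordinal i0N)) /=; last by rewrite -val_eqE eq_sym.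
    rewrite big1 ?addr0 => [|j /andP[]]; last first.
      by rewrite -!val_eqE /b => /negbTE -> /negbTE ->; rewrite scale0r.
    rewrite /b !eqxx eq_sym (negbTE ii).
    have := linspanB (linspanZ c0 mc) (linspanZ c mc0).
    rewrite !scalerBr !scalerA [c * c0]mulrC opprB addrA subrK.
    by rewrite scaleNr.
  move=> /(basis_independent GK HG basisM) /(_ i iN) /eqP.
  by rewrite /b eqxx (negbTE c0_neq0).
- move=> m /(nthP [::])[i iN <-]; have [_ xd _ xK] := xP i iN.
  have xG : wspan (gword G) (x i) by apply: wspan_sub xd => w [].
  have [Phi dPhi xPhi] := socle_contract GK HG w0G w0d w0K topK xG.
  have [phi dphi phiE] := dual_family_specialize HK (gword_sub GK w0G) dPhi.
  (* The family contracts [w0], whereas m0 is [c0] times [w0] modulo [K]. *)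
  have dq := dual_family_scale c0^-1 dphi; pose q w := c0^-1 * phi w.
  have qL v : prodspan n H (Kn n) v -> lin (q : word -> rat^o) v = 0.
    by case: dq => [/(_ [::] v isT)].
  exists q; split; last split.
  + split=> [P /inI_ideal IP|]; first by rewrite ev_lin; apply/qL/ideal_prodspan.
    by case: dq => _ _ [D qD]; exists D => w; apply: (qD w [::]).
  + by move=> P /(inProd_prodspan (fun _ _ => id) HK) PL; rewrite ev_lin qL.
  apply/(inProd_prodspan GK HG); rewrite toF_cat toF_popp toF_star -/(mu i) -/(mu i0).
  have qE : contract (fun u _ => q u) (c0 *: e w0) = contract Phi (e w0).
    rewrite -phiE linearZ /= !linE /q (copsum_ext _ (g := fun u y => c0^-1 *: (phi u *: e y))).
      by rewrite copsum_scale scalerA mulfV // scale1r.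
    by move=> u y; rewrite scalerA.
  have := contract_K GK dq mc0; rewrite linearB /= qE => qm0.
  have := linspanB (linspanD (muP i iN) xPhi) qm0.
  by rewrite addrA subrK opprB addrA subrK.
- move=> m /(nthP [::])[i iN <-]; have [_ xd _ xK] := xP i iN.
  have [w [wG wd wK]] := reach_socle GK HG w0G w0d w0K topK xd xK.
  have xwd : homG G d0 (rmul w (x i)).
    apply: wspan_lin xd => [|u [uG ud]]; first exact: linspan_subspace.
    by rewrite rmulE; apply: wspan_e; rewrite gword_cat uG size_cat ud addnC.
  have [c xc] := socle_line GK HG w0G w0d w0K topK xwd.
  have c_neq0 : c != 0.
    by apply/eqP => c_eq0; apply: wK; move: xc; rewrite c_eq0 scale0r subr0.
  (* Modulo [K], m w is [c] times [w0] and m0 is [c0] times [w0]. *)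
  exists [:: (c0 / c, w)]; split.
    exists [:: (c0 / c, w)]; split; first by move=> t; rewrite inE => /eqP ->.
    by apply/eqFK_ideal; rewrite subrr; apply: linspan0.
  apply/(inProd_prodspan GK HG); rewrite toF_cat toF_popp toF_pmul -/(mu i) -/(mu i0).
  have -> : mulF (mu i) (toF [:: (c0 / c, w)]) = (c0 / c) *: rmul w (mu i).
    by rewrite /toF big_seq1 linearZ /= mulF_er.
  have mw : K (rmul w (mu i) - c *: e w0).
    rewrite -(subrKA (rmul w (x i))); apply: linspanD => //.
    by rewrite -linearB; apply: K_rmul => //; apply: muP.
  have := linspanB mc0 (linspanZ (c0 / c) mw).
  by rewrite scalerBr scalerA divfK // opprB addrA subrK.
Qed.
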